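(* Let $r\ge1$ be an arbitrary natural number and let $B_k^*$ ($k\ge1$) be the Bernoulli numbers. Then the Riemann zeta function satisfies $$\begin{aligned}\zeta(2r+1)=\ &\frac{2^{2r+1}3^{2r}}{3^{2r}(2^{2r}+1)+2^{2r}-1}\sum_{k=1}^{r-1}(-1)^{k-1}\frac{1}{(2k)!}\left(\frac{\pi}{3}\right)^{2k}\zeta(2r+1-2k)\\&+(-1)^{r-1}\frac{2^{2r+1}\pi^{2r}}{(3^{2r}(2^{2r}+1)+2^{2r}-1)(2r)!}\left(H_{2r}-\ln\frac{\pi}{3}\right)\\&+(-1)^{r-1}\frac{4(2\pi)^{2r}}{3^{2r}(2^{2r}+1)+2^{2r}-1}\sum_{k=1}^\infty\frac{(2k-1)!}{(2r+2k)!}\frac{\zeta(2k)}{6^{2k}},\end{aligned}$$ or, equivalently, $$\begin{aligned}\zeta(2r+1)=\ &\frac{2^{2r+1}3^{2r}}{3^{2r}(2^{2r}+1)+2^{2r}-1}\sum_{k=1}^{r-1}(-1)^{k-1}\frac{1}{(2k)!}\left(\frac{\pi}{3}\right)^{2k}\zeta(2r+1-2k)\\&+(-1)^{r-1}\frac{2^{2r+1}\pi^{2r}}{(3^{2r}(2^{2r}+1)+2^{2r}-1)(2r)!}\left(H_{2r}-\ln\frac{\pi}{3}\right)\\&+(-1)^{r-1}\frac{(2\pi)^{2r}}{3^{2r}(2^{2r}+1)+2^{2r}-1}\sum_{k=1}^\infty\frac{B_k^*}{(2r+2k)!\,k}\left(\frac{\pi}{3}\right)^{2k}.\end{aligned}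$$
   Context: $H_m=\sum_{j=1}^m 1/j$ are the harmonic numbers. The Bernoulli numbers $B_k^*$ are determined by $\sum_{k=0}^{s-1}(-1)^k\binom{2s+1}{2k+1}B_{k+1}^*=\frac12$ for all natural $s\ge1$ (so $B_1^*=1/6$, $B_2^*=1/30$; in modern notation $B_k^*=|B_{2k}|$). An empty sum is $0$. *)

(* Defs.v *)
From Stdlib Require Import Reals Lra Lia Arith.
From Coquelicot Require Import Coquelicot.
Open Scope R_scope.

(* The Riemann zeta function on the half-line s > 1, by its Dirichlet series.
   For s <= 1 the series diverges and the value is meaningless. *)
Definition zeta (s : R) : R := Series (fun n => / Rpower (INR (S n)) s).

(* [sum_n_m] is zero when the upper bound is below the lower one, so [harmonic 0 = 0]. *)
Definition harmonic (m : nat) : R := sum_n_m (fun j => / INR j) 1 m.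

(* The recurrence determining B_1, B_2, ...; the value [B 0] is irrelevant.
   [Binomial.C] is the binomial coefficient of the standard library
   ([C] alone denotes Coquelicot's complex numbers). *)
Definition is_bernoulli_star (B : nat -> R) : Prop :=
  forall s : nat, (1 <= s)%nat ->
    sum_n_m (fun k => (-1) ^ k * Binomial.C (2 * s + 1) (2 * k + 1) * B (k + 1)%nat)
      0 (s - 1) = 1 / 2 :> R.

Lemma bernoulli_star_term_neq0 (n : nat) :
  (-1) ^ n * Binomial.C (2 * S n + 1) (2 * n + 1) <> 0.
Proof.
apply Rmult_integral_contrapositive_currified.
- apply pow_nonzero; lra.
- unfold Binomial.C, Rdiv.
  apply Rmult_integral_contrapositive_currified; [apply INR_fact_neq_0|].
  apply Rinv_neq_0_compat.
  apply Rmult_integral_contrapositive_currified; apply INR_fact_neq_0.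
Qed.

Lemma bernoulli_star_step (B : nat -> R) (n : nat) :
  sum_n_m (fun k => (-1) ^ k * Binomial.C (2 * S n + 1) (2 * k + 1) * B (k + 1)%nat)
    0 (S n - 1)
  = match n return R with
    | O => 0
    | S p => sum_n_m (fun k => (-1) ^ k * Binomial.C (2 * S n + 1) (2 * k + 1)
                               * B (k + 1)%nat) 0 p
    end + (-1) ^ n * Binomial.C (2 * S n + 1) (2 * n + 1) * B (S n) :> R.
Proof.
replace (S n - 1)%nat with n by lia.
destruct n as [|p].
- rewrite sum_n_n. rewrite Rplus_0_l. reflexivity.
- rewrite sum_n_Sm by lia. replace (S p + 1)%nat with (S (S p)) by lia. reflexivity.
Qed.

Fixpoint bernoulli_star_table (n : nat) : nat -> R :=
  match n with
  | O => fun _ => 0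
  | S p => fun k =>
      if (k =? S p)%nat then
        (1 / 2 - match p with
                 | O => 0
                 | S q => sum_n_m (fun k => (-1) ^ k * Binomial.C (2 * S p + 1) (2 * k + 1)
                                    * bernoulli_star_table p (k + 1)%nat) 0 q
                 end) / ((-1) ^ p * Binomial.C (2 * S p + 1) (2 * p + 1))
      else bernoulli_star_table p k
  end.

Lemma bernoulli_star_table_stable (k d : nat) :
  bernoulli_star_table (k + d) k = bernoulli_star_table k k.
Proof.
induction d as [|d IH].
- now rewrite Nat.add_0_r.
- rewrite Nat.add_succ_r.
  change (bernoulli_star_table (S (k + d)) k) with
    (if (k =? S (k + d))%nat then
       (1 / 2 - match (k + d)%nat with
                | O => 0
                | S q => sum_n_m (fun j => (-1) ^ j * Binomial.C (2 * S (k + d) + 1) (2 * j + 1)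
                                   * bernoulli_star_table (k + d) (j + 1)%nat) 0 q
                end) / ((-1) ^ (k + d) * Binomial.C (2 * S (k + d) + 1) (2 * (k + d) + 1))
     else bernoulli_star_table (k + d) k).
  destruct (Nat.eqb_spec k (S (k + d))) as [E|_]; [lia | exact IH].
Qed.

Lemma is_bernoulli_star_exists : exists B, is_bernoulli_star B.
Proof.
exists (fun k => bernoulli_star_table k k).
intros [|n] hs; [lia|].
refine (eq_trans (bernoulli_star_step (fun k => bernoulli_star_table k k) n) _).
cbv beta.
change (bernoulli_star_table (S n) (S n)) with
  (if (S n =? S n)%nat then
     (1 / 2 - match n with
              | O => 0
              | S q => sum_n_m (fun j => (-1) ^ j * Binomial.C (2 * S n + 1) (2 * j + 1)
                                 * bernoulli_star_table n (j + 1)%nat) 0 q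
              end) / ((-1) ^ n * Binomial.C (2 * S n + 1) (2 * n + 1))
   else bernoulli_star_table n (S n)).
rewrite Nat.eqb_refl.
pose proof (bernoulli_star_term_neq0 n) as hc.
set (c := (-1) ^ n * Binomial.C (2 * S n + 1) (2 * n + 1)) in *.
destruct n as [|p]; [now field|].
rewrite (sum_n_m_ext_loc _
  (fun j => (-1) ^ j * Binomial.C (2 * S (S p) + 1) (2 * j + 1)
            * bernoulli_star_table (S p) (j + 1)%nat)).
- now field.
- intros k hk.
  rewrite <- (bernoulli_star_table_stable (k + 1) (p - k)).
  now replace (k + 1 + (p - k))%nat with (S p) by lia.
Qed.

Lemma is_bernoulli_star_unique (B B' : nat -> R) :
  is_bernoulli_star B -> is_bernoulli_star B' ->
  forall k : nat, (1 <= k)%nat -> B k = B' k.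
Proof.
intros hB hB' k.
induction k as [k IH] using lt_wf_ind.
intros hk; destruct k as [|n]; [lia|].
pose proof (hB (S n) hk) as e; pose proof (hB' (S n) hk) as e'.
rewrite bernoulli_star_step in e; rewrite bernoulli_star_step in e'.
apply Rmult_eq_reg_l with (2 := bernoulli_star_term_neq0 n).
destruct n as [|p]; [lra|].
rewrite (sum_n_m_ext_loc _
  (fun k => (-1) ^ k * Binomial.C (2 * S (S p) + 1) (2 * k + 1) * B' (k + 1)%nat)) in e.
- lra.
- intros j hj; rewrite (IH (j + 1)%nat); [reflexivity | lia | lia].
Qed.

(* Main.v *)
Require Import Defs.
From Stdlib Require Import Reals Arith Lra Lia.
From Coquelicot Require Import Coquelicot.
Open Scope R_scope.

(* The sums [F_s(x) = sum_n cos (n x - s pi/2 + phi) / n^s] satisfy [F_(s+1)' = F_s], so each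
   is obtained from [F_1] by repeated integration, the constants being values of zeta.
   For [phi = 0], [F_1(x) = (pi - x)/2] and [F_s] is a polynomial on [(0, 2 pi)]; periodicity
   [F_s(2 pi) = F_s(0)] is a recurrence for the [zeta(2k)], which gives both
   [zeta(2k) = (2 pi)^(2k) B_k / (2 (2k)!)] and the power series of [(x/2) cot (x/2)], hence of
   [ln (2 sin (x/2))].
   For [phi = pi/2], [F_1(x) = - ln (2 sin (x/2))]; integrating its expansion [2r] times and
   setting [x = pi/3] yields the theorem, because [cos (n pi/3)] is a combination of the
   indicators of [1 | n], [2 | n], [3 | n], [6 | n], so that
   [sum_n cos (n pi/3) / n^(2r+1) = (1 - 2^(-2r)) (1 - 3^(-2r)) zeta(2r+1) / 2]. *)

(** * Term-by-term integration of trigonometric series *)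

Definition trig_term (phi : R) (s : nat) (x : R) (n : nat) : R :=
  cos (INR (S n) * x - INR s * (PI / 2) + phi) / INR (S n) ^ s.

Definition trig_sum (phi : R) (s N : nat) (x : R) : R := sum_n (trig_term phi s x) N.

Definition trig_series (phi : R) (s : nat) (x : R) : R := Series (trig_term phi s x).

Definition converges_inside (b : R) (f : nat -> R -> R) (g : R -> R) : Prop :=
  forall d e : R, 0 < d -> 0 < e ->
  exists N0 : nat, forall (N : nat) (x : R), (N0 <= N)%nat -> d <= x <= b - d ->
    Rabs (f N x - g x) <= e.

Lemma INR_S_pos (n : nat) : 0 < INR (S n).
Proof. apply lt_0_INR; lia. Qed.

Lemma zeta_INR (j : nat) : zeta (INR j) = Series (fun n => / INR (S n) ^ j).
Proof.
unfold zeta; apply Series_ext; intros n.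
now rewrite Rpower_pow by apply INR_S_pos.
Qed.

Lemma inv_pow_ge2 (s n : nat) : (2 <= s)%nat ->
  0 < / INR (S n) ^ s <= / INR (S n) ^ 2.
Proof.
intros hs; pose proof (INR_S_pos n) as h.
assert (h1 : 1 <= INR (S n)) by (rewrite S_INR; pose proof (pos_INR n); lra).
split; [apply Rinv_0_lt_compat, pow_lt, h|].
apply Rinv_le_contravar; [apply pow_lt, h|].
now apply Rle_pow.
Qed.

Lemma inv_sqr_telescope (n : nat) :
  / INR (S (S n)) ^ 2 <= / INR (S n) - / INR (S (S n)).
Proof.
pose proof (INR_S_pos n) as h; rewrite (S_INR (S n)); set (y := INR (S n)) in *.
replace (/ y - / (y + 1)) with (/ (y * (y + 1))) by (field; lra).
apply Rinv_le_contravar; nra.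
Qed.

Lemma tail_bound (c : nat -> R) (N k : nat) :
  (forall n, Rabs (c n) <= / INR (S n) ^ 2) ->
  Rabs (sum_n c (N + k) - sum_n c N) <= / INR (S N) - / INR (S (N + k)).
Proof.
intros hc; induction k as [|k IH].
- rewrite Nat.add_0_r, !Rminus_diag, Rabs_R0; lra.
- rewrite Nat.add_succ_r, sum_Sn.
  change (Rabs (sum_n c (N + k) + c (S (N + k)) - sum_n c N)
    <= / INR (S N) - / INR (S (S (N + k)))).
  pose proof (hc (S (N + k))); pose proof (inv_sqr_telescope (N + k)).
  pose proof (Rabs_triang (sum_n c (N + k) - sum_n c N) (c (S (N + k)))) as ht.
  replace (sum_n c (N + k) + c (S (N + k)) - sum_n c N)
    with (sum_n c (N + k) - sum_n c N + c (S (N + k))) by ring.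
  lra.
Qed.

Lemma ex_series_inv_pow (s : nat) : (2 <= s)%nat -> ex_series (fun n => / INR (S n) ^ s).
Proof.
intros hs.
assert (h : forall n, Rabs (/ INR (S n) ^ s) <= / INR (S n) ^ 2).
{ intros n; destruct (inv_pow_ge2 s n hs); rewrite Rabs_pos_eq; lra. }
apply ex_finite_lim_seq_incr with (M := 2).
- intros n; rewrite sum_Sn; destruct (inv_pow_ge2 s (S n) hs); unfold plus; simpl in *; lra.
- intros n; pose proof (tail_bound _ 0 n h) as ht; rewrite sum_O in ht; simpl Nat.add in ht.
  pose proof (Rinv_0_lt_compat _ (INR_S_pos n)).
  apply Rabs_le_between in ht; rewrite INR_1, Rinv_1, pow1, Rinv_1 in ht.
  change (sum_n (fun m => / INR (S m) ^ s) n <= 2); lra.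
Qed.

Lemma ex_series_quadratic (c : nat -> R) :
  (forall n, Rabs (c n) <= / INR (S n) ^ 2) -> ex_series c.
Proof.
intros hc; apply (ex_series_le (V := R_CompleteNormedModule)) with (b := fun n => / INR (S n) ^ 2); [exact hc|].
now apply ex_series_inv_pow.
Qed.

Lemma series_tail_bound (c : nat -> R) (N : nat) :
  (forall n, Rabs (c n) <= / INR (S n) ^ 2) ->
  Rabs (sum_n c N - Series c) <= / INR (S N).
Proof.
intros hc.
assert (hl : is_lim_seq (fun k => Rabs (sum_n c (k + N) - sum_n c N))
                        (Rabs (Series c - sum_n c N))).
{ apply (is_lim_seq_abs _ (Finite (Series c - sum_n c N))).
  apply is_lim_seq_minus'; [|apply is_lim_seq_const].
  apply (is_lim_seq_incr_n (sum_n c) N).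
  exact (Series_correct _ (ex_series_quadratic c hc)). }
rewrite Rabs_minus_sym.
refine (is_lim_seq_le _ (fun _ => / INR (S N)) (Finite _) (Finite _) _ hl
  (is_lim_seq_const _)).
intros k; rewrite Nat.add_comm; pose proof (tail_bound c N k hc).
pose proof (Rinv_0_lt_compat _ (INR_S_pos (N + k))); lra.
Qed.

Lemma trig_term_bound (phi : R) (s : nat) (x : R) (n : nat) : (2 <= s)%nat ->
  Rabs (trig_term phi s x n) <= / INR (S n) ^ 2.
Proof.
intros hs; unfold trig_term, Rdiv; rewrite Rabs_mult.
destruct (inv_pow_ge2 s n hs) as [h0 h].
rewrite (Rabs_pos_eq (/ _)) by lra.
assert (Rabs (cos (INR (S n) * x - INR s * (PI * / 2) + phi)) <= 1).
{ apply Rabs_le; split; apply COS_bound. }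
nra.
Qed.

Lemma trig_tail_bound (phi : R) (s N : nat) (x : R) : (2 <= s)%nat ->
  Rabs (trig_sum phi s N x - trig_series phi s x) <= / INR (S N).
Proof. intros hs; apply series_tail_bound; intros n; now apply trig_term_bound. Qed.

Lemma trig_series_0 (phi : R) (s : nat) :
  trig_series phi s 0 = cos (phi - INR s * (PI / 2)) * zeta (INR s).
Proof.
unfold trig_series; rewrite zeta_INR, <- Series_scal_l; apply Series_ext; intros n.
unfold trig_term.
now replace (INR (S n) * 0 - INR s * (PI / 2) + phi) with (phi - INR s * (PI / 2)) by ring.
Qed.

Lemma trig_series_2PI (phi : R) (s : nat) :
  trig_series phi s (2 * PI) = trig_series phi s 0.
Proof.
apply Series_ext; intros n; unfold trig_term; f_equal.
rewrite <- (cos_period (INR (S n) * 0 - _ + _) (S n)); f_equal; ring.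
Qed.

Lemma inv_INR_S_lim : is_lim_seq (fun n => / INR (S n)) 0.
Proof.
apply (is_lim_seq_incr_1 (fun n => / INR n)).
apply (is_lim_seq_inv _ p_infty); [apply is_lim_seq_INR | discriminate].
Qed.

Lemma inv_INR_S_small (e : R) : 0 < e ->
  exists N0, forall N, (N0 <= N)%nat -> / INR (S N) <= e.
Proof.
intros he.
destruct (proj2 (is_lim_seq_spec _ _) inv_INR_S_lim (mkposreal e he)) as [N0 h].
exists N0; intros N hN; specialize (h N hN); simpl in h.
apply Rabs_lt_between in h; simpl; lra.
Qed.

Lemma trig_sum_derive (phi : R) (s N : nat) (x : R) :
  is_derive (trig_sum phi (S s) N) x (trig_sum phi s N x).
Proof.
unfold trig_sum.
apply (is_derive_sum_n (fun n y => trig_term phi (S s) y n)).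
intros n _; unfold trig_term; pose proof (INR_S_pos n) as h.
assert (hs : INR (S s) * (PI / 2) = INR s * (PI / 2) + PI / 2)
  by (rewrite (S_INR s); field).
set (c := INR (S n)) in *; set (t := INR (S s) * (PI / 2)) in *; clearbody c t.
auto_derive; [trivial|].
replace (c * x - INR s * (PI / 2) + phi) with (PI / 2 + (c * x + - t + phi))
  by (rewrite hs; ring).
rewrite sin_cos; field.
split; [apply pow_nonzero; lra | lra].
Qed.

Lemma trig_series_continuous (phi : R) (s : nat) (x : R) : (2 <= s)%nat ->
  continuous (trig_series phi s) x.
Proof.
intros hs; apply filterlim_locally; intros e.
assert (he : 0 < e / 4) by (pose proof (cond_pos e); lra).
destruct (inv_INR_S_small _ he) as [N hN]; specialize (hN N (le_n N)).
destruct s as [|s]; [lia|].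
assert (hc : continuous (trig_sum phi (S s) N) x).
{ apply (ex_derive_continuous (trig_sum phi (S s) N)).
  eexists; apply trig_sum_derive. }
generalize (proj1 (filterlim_locally _ _) hc (mkposreal _ he)).
apply filter_imp; intros y hy.
pose proof (trig_tail_bound phi (S s) N x hs) as h1.
pose proof (trig_tail_bound phi (S s) N y hs) as h2.
change (Rabs (trig_sum phi (S s) N y - trig_sum phi (S s) N x) < e / 4) in hy.
change (Rabs (trig_series phi (S s) y - trig_series phi (S s) x) < e).
apply Rabs_le_between in h1; apply Rabs_le_between in h2; apply Rabs_lt_between in hy.
apply Rabs_def1; lra.
Qed.

Lemma converges_inside_eq (phi b : R) (s : nat) (g : R -> R) (x : R) : (2 <= s)%nat ->
  converges_inside b (trig_sum phi s) g -> 0 < x < b -> trig_series phi s x = g x.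
Proof.
intros hs hU hx.
apply Rminus_diag_uniq, Rabs_eq_0, Rle_antisym; [|apply Rabs_pos].
apply le_epsilon; intros e he; rewrite Rplus_0_l.
assert (he2 : 0 < e / 2) by lra.
destruct (hU (Rmin x (b - x)) (e / 2)) as [N0 h]; [apply Rmin_glb_lt; lra | exact he2 |].
destruct (inv_INR_S_small _ he2) as [N1 h1].
specialize (h (N0 + N1)%nat x); specialize (h1 (N0 + N1)%nat).
pose proof (Rmin_l x (b - x)); pose proof (Rmin_r x (b - x)).
assert (h' := h ltac:(lia) ltac:(lra)); assert (h1' := h1 ltac:(lia)).
pose proof (trig_tail_bound phi s (N0 + N1) x hs) as h2.
apply Rabs_le_between in h'; apply Rabs_le_between in h2; apply Rabs_le; lra.
Qed.

Lemma derive_dominated (f df h dh : R -> R) (x y : R) : x <= y ->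
  (forall t, x <= t <= y -> is_derive f t (df t)) ->
  (forall t, x <= t <= y -> is_derive h t (dh t)) ->
  (forall t, x <= t <= y -> Rabs (df t) <= dh t) ->
  Rabs (f y - f x) <= h y - h x.
Proof.
intros hxy hf hh hle.
assert (h1 : forall t, Rmin x y <= t <= Rmax x y -> x <= t <= y).
{ intros t; rewrite Rmin_left, Rmax_right; lra. }
assert (hinc : forall g dg : R -> R, (forall t, x <= t <= y -> is_derive g t (dg t)) ->
  (forall t, x <= t <= y -> 0 <= dg t) -> g x <= g y).
{ intros g dg hg hdg.
  destruct (MVT_gen g x y dg) as [c [hc hc']].
  - intros t ht; apply hg, h1; lra.
  - intros t ht; apply continuity_pt_filterlim, (ex_derive_continuous g).
    exists (dg t); apply hg, h1, ht.
  - specialize (hdg c (h1 c hc)); nra. }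
assert (hm := hinc (fun t => h t - f t) (fun t => dh t - df t)).
assert (hp := hinc (fun t => h t + f t) (fun t => dh t + df t)).
apply Rabs_le; split; [apply Rplus_le_reg_l with (h y - h x + f x) | ].
- apply Rle_trans with (f x); [lra|]; cbv beta in hp; enough (h x + f x <= h y + f y) by lra.
  apply hp; intros t ht.
  + apply (is_derive_plus h f); auto.
  + specialize (hle t ht); apply Rabs_le_between in hle; lra.
- cbv beta in hm; enough (h x - f x <= h y - f y) by lra.
  apply hm; intros t ht.
  + apply (is_derive_minus h f); auto.
  + specialize (hle t ht); apply Rabs_le_between in hle; lra.
Qed.

Lemma derive_small_oscillation (f df : R -> R) (e x y : R) : x <= y ->
  (forall t, x <= t <= y -> is_derive f t (df t) /\ Rabs (df t) <= e) ->
  Rabs (f y - f x) <= e * (y - x).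
Proof.
intros hxy h; rewrite Rmult_minus_distr_l.
apply (derive_dominated f df (Rmult e) (fun _ => e) x y hxy); intros t ht.
- now apply h.
- evar_last; [apply is_derive_scal, is_derive_id | apply Rmult_1_r].
- now apply h.
Qed.

Lemma small_oscillation_sym (f df : R -> R) (e x y a b : R) : a <= x <= b -> a <= y <= b ->
  (forall t, a <= t <= b -> is_derive f t (df t) /\ Rabs (df t) <= e) ->
  Rabs (f y - f x) <= e * (b - a).
Proof.
intros hx hy h.
assert (he : 0 <= e) by (pose proof (Rabs_pos (df x)); destruct (h x hx); lra).
destruct (Rle_dec x y).
- apply Rle_trans with (e * (y - x)); [|nra].
  apply derive_small_oscillation with df; [lra | intros t ht; apply h; lra].
- rewrite Rabs_minus_sym; apply Rle_trans with (e * (x - y)); [|nra].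
  apply derive_small_oscillation with df; [lra | intros t ht; apply h; lra].
Qed.

Lemma const_eq_right_limit (f : R -> R) (b l : R) : 0 < b ->
  (forall x y, 0 < x < b -> 0 < y < b -> f x = f y) ->
  filterlim f (at_right 0) (locally l) -> forall x, 0 < x < b -> f x = l.
Proof.
intros hb hc hl x hx.
apply (filterlim_locally_unique (F := at_right 0) f); [|exact hl].
apply filterlim_ext_loc with (f := fun _ : R => f x); [|apply filterlim_const].
exists (mkposreal b hb); intros y hy hy0.
change (Rabs (y - 0) < b) in hy; apply Rabs_lt_between in hy.
apply hc; lra.
Qed.

(* [trig_sum phi (S s) N - G] has derivative [trig_sum phi s N - g], hence is almost
   constant on compact subintervals; the value at [0+] fixes the constant. *)
Lemma converges_inside_primitive (phi b : R) (s : nat) (g G : R -> R) :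
  0 < b -> (1 <= s)%nat ->
  converges_inside b (trig_sum phi s) g ->
  (forall x, 0 < x < b -> is_derive G x (g x)) ->
  filterlim G (at_right 0)
    (locally (cos (phi - INR (S s) * (PI / 2)) * zeta (INR (S s)))) ->
  converges_inside b (trig_sum phi (S s)) G.
Proof.
intros hb hs hU hG h0.
assert (hs2 : (2 <= S s)%nat) by lia.
assert (heq : forall x, 0 < x < b -> trig_series phi (S s) x = G x).
{ intros x hx; apply Rminus_diag_uniq; revert x hx.
  apply (const_eq_right_limit (fun x => trig_series phi (S s) x - G x) b 0 hb).
  - intros x y hx hy.
    apply Rminus_diag_uniq, Rabs_eq_0, Rle_antisym; [|apply Rabs_pos].
    apply le_epsilon; intros e he; rewrite Rplus_0_l.
    set (lo := Rmin x y); set (hi := Rmax x y).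
    assert (hlo : 0 < lo) by (apply Rmin_glb_lt; lra).
    assert (hhi : hi < b) by (apply Rmax_lub_lt; lra).
    pose proof (Rmin_l x y); pose proof (Rmin_r x y).
    pose proof (Rmax_l x y); pose proof (Rmax_r x y).
    fold lo in H, H0; fold hi in H1, H2.
    set (e' := e / (2 * b)).
    assert (he' : 0 < e') by (apply Rdiv_lt_0_compat; lra).
    destruct (hU (Rmin lo (b - hi)) e') as [N0 h]; [apply Rmin_glb_lt; lra | exact he' |].
    pose proof (Rmin_l lo (b - hi)); pose proof (Rmin_r lo (b - hi)).
    destruct (inv_INR_S_small (e / 4)) as [N1 h1]; [lra|].
    set (N := (N0 + N1)%nat).
    assert (h1' := h1 N ltac:(unfold N; lia)).
    pose proof (trig_tail_bound phi (S s) N x hs2) as hx'.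
    pose proof (trig_tail_bound phi (S s) N y hs2) as hy'.
    assert (hm : Rabs ((trig_sum phi (S s) N x - G x) - (trig_sum phi (S s) N y - G y))
                 <= e' * (hi - lo)).
    { apply (small_oscillation_sym (fun t => trig_sum phi (S s) N t - G t)
               (fun t => trig_sum phi s N t - g t)); [lra | lra |].
      intros t ht; split.
      - apply (is_derive_minus (trig_sum phi (S s) N) G); [apply trig_sum_derive | apply hG; lra].
      - apply h; [unfold N; lia | lra]. }
    assert (hb' : e' * (hi - lo) <= e / 2).
    { apply Rle_trans with (e' * b); [apply Rmult_le_compat_l; lra|].
      unfold e'; apply Req_le; field; lra. }
    apply Rabs_le_between in hm; apply Rabs_le_between in hx'; apply Rabs_le_between in hy'.
    apply Rabs_le; lra.
  - rewrite <- trig_series_0 in h0.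
    set (l := trig_series phi (S s) 0) in *.
    replace 0 with (plus l (opp l)) at 2 by apply Rplus_opp_r.
    apply (filterlim_comp_2 (H := locally (opp l)) (trig_series phi (S s))
             (fun x => opp (G x)) plus (G := locally l)).
    + apply (filterlim_filter_le_1 (F := locally 0)); [apply filter_le_within|].
      exact (trig_series_continuous phi (S s) 0 hs2).
    + apply (filterlim_comp _ _ _ G opp _ _ _ h0), (filterlim_opp (V := R_NormedModule)).
    + apply (filterlim_plus (V := R_NormedModule)). }
intros d e hd he.
destruct (inv_INR_S_small e he) as [N0 h]; exists N0; intros N x hN hx.
rewrite <- heq by lra.
apply Rle_trans with (2 := h N hN); now apply trig_tail_bound.
Qed.

(** * Fourier series of order one *)

(* [trig_sum phi 0 N x] is the sum of [cos (n x + phi)] over [1 <= n <= N + 1]. *)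
Lemma dirichlet_kernel (phi x : R) (N : nat) :
  2 * sin (x / 2) * trig_sum phi 0 N x
  = sin (INR (S N) * x + x / 2 + phi) - sin (x / 2 + phi).
Proof.
assert (hstep : forall y, sin (y + x / 2) - sin (y - x / 2) = 2 * sin (x / 2) * cos y)
  by (intros y; rewrite sin_plus, sin_minus; ring).
assert (hterm : forall n, trig_term phi 0 x n = cos (INR (S n) * x + phi)).
{ intros n; unfold trig_term; rewrite Rdiv_1_r; f_equal; simpl (INR 0); ring. }
unfold trig_sum; induction N as [|N IH].
- rewrite sum_O, hterm, <- hstep, INR_1.
  f_equal; f_equal; field.
- rewrite sum_Sn; change plus with Rplus.
  rewrite Rmult_plus_distr_l, IH, hterm, <- hstep, (S_INR (S N)).
  replace ((INR (S N) + 1) * x + phi - x / 2) with (INR (S N) * x + x / 2 + phi) by field.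
  replace ((INR (S N) + 1) * x + phi + x / 2) with ((INR (S N) + 1) * x + x / 2 + phi) by ring.
  ring.
Qed.

Lemma sin_half_lower (d x : R) : 0 < d <= PI -> d <= x <= 2 * PI - d -> sin (d / 2) <= sin (x / 2).
Proof.
intros hd hx; destruct (Rle_dec x PI).
- apply sin_incr_1; lra.
- rewrite <- (sin_PI_x (x / 2)); apply sin_incr_1; lra.
Qed.

(* The correction [cos ((N + 3/2) x + phi) / ((N + 3/2) 2 sin (x/2))] absorbs the oscillating
   part of the Dirichlet kernel; the remaining derivative is [O(1/N)]. *)
Lemma converges_inside_base (phi : R) (g : R -> R) :
  (forall x, 0 < x < 2 * PI -> is_derive g x (- sin (x / 2 + phi) / (2 * sin (x / 2)))) ->
  is_lim_seq (fun N => trig_sum phi 1 N PI) (g PI) ->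
  converges_inside (2 * PI) (trig_sum phi 1) g.
Proof.
intros hg hpi d e hd he.
destruct (Rle_dec d PI) as [hdpi|hdpi].
2: { exists 0%nat; intros N x _ hx; lra. }
pose proof PI_RGT_0 as hPI.
set (c := sin (d / 2)).
assert (hc : 0 < c) by (apply sin_gt_0; lra).
set (K := 1 / c + 1 / (4 * c * c) * (2 * PI)).
assert (hK : 0 < K).
{ apply Rplus_lt_0_compat; [apply Rdiv_lt_0_compat; lra|].
  apply Rmult_lt_0_compat; [apply Rdiv_lt_0_compat; nra | lra]. }
assert (he2 : 0 < e / 2) by lra.
destruct (proj2 (is_lim_seq_spec _ _) hpi (mkposreal _ he2)) as [N0 h0]; simpl pos in h0.
destruct (inv_INR_S_small (e / 2 / K)) as [N1 h1]; [apply Rdiv_lt_0_compat; lra|].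
exists (N0 + N1)%nat; intros N x hN hx.
specialize (h0 N ltac:(lia)); specialize (h1 N ltac:(lia)).
pose proof (INR_S_pos N) as hS; set (M := INR (S N)) in *.
set (m := M + 1 / 2); assert (hm : 0 < m) by (unfold m; lra).
assert (hmi : / m <= / M) by (apply Rinv_le_contravar; unfold m; lra).
assert (hmi0 : 0 < / m) by now apply Rinv_0_lt_compat.
set (h := fun t => - cos (m * t + phi) / (m * (2 * sin (t / 2)))).
assert (hs : forall t, d <= t <= 2 * PI - d -> c <= sin (t / 2))
  by (intros t ht; now apply sin_half_lower).
assert (hh : forall t, d <= t <= 2 * PI - d -> Rabs (h t) <= / m * / (2 * c)).
{ intros t ht; specialize (hs t ht); unfold h, Rdiv.
  rewrite Rabs_mult, Rabs_Ropp, Rinv_mult, (Rabs_pos_eq (/ m * _)).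
  2: { apply Rlt_le, Rmult_lt_0_compat; [lra | apply Rinv_0_lt_compat; lra]. }
  assert (Rabs (cos (m * t + phi)) <= 1) by (apply Rabs_le; split; apply COS_bound).
  assert (/ (2 * sin (t * / 2)) <= / (2 * c)) by (apply Rinv_le_contravar; lra).
  assert (0 < / (2 * sin (t * / 2))) by (apply Rinv_0_lt_compat; lra).
  pose proof (Rabs_pos (cos (m * t + phi))).
  rewrite <- (Rmult_1_l (/ m * / (2 * c))).
  apply Rmult_le_compat; [lra | nra | lra | apply Rmult_le_compat_l; lra]. }
set (dh := fun t => cos (m * t + phi) * cos (t / 2) / (m * (4 * (sin (t / 2) * sin (t / 2))))).
assert (hder : forall t, d <= t <= 2 * PI - d ->
  is_derive (fun y => trig_sum phi 1 N y - g y - h y) t (- dh t)).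
{ intros t ht; pose proof (hs t ht) as hst.
  replace (- dh t) with
    (minus (minus (trig_sum phi 0 N t) (- sin (t / 2 + phi) / (2 * sin (t / 2))))
       (sin (m * t + phi) / (2 * sin (t / 2)) + dh t)).
  - apply (is_derive_minus (fun y => trig_sum phi 1 N y - g y) h).
    + apply (is_derive_minus (trig_sum phi 1 N) g); [apply trig_sum_derive | apply hg; lra].
    + unfold h, dh; auto_derive.
      * apply Rmult_integral_contrapositive_currified; unfold Rdiv in hst; lra.
      * unfold Rdiv in *; field; lra.
  - change (trig_sum phi 0 N t - - sin (t / 2 + phi) / (2 * sin (t / 2))
       - (sin (m * t + phi) / (2 * sin (t / 2)) + dh t) = - dh t).
    replace (trig_sum phi 0 N t)
      with ((2 * sin (t / 2) * trig_sum phi 0 N t) / (2 * sin (t / 2))) by (field; lra).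
    rewrite dirichlet_kernel.
    replace (INR (S N) * t + t / 2 + phi) with (m * t + phi) by (unfold m, M; field).
    field; lra. }
assert (hosc := small_oscillation_sym (fun y => trig_sum phi 1 N y - g y - h y)
  (fun t => - dh t) (/ m * (1 / (4 * c * c))) PI x d (2 * PI - d)
  ltac:(lra) ltac:(lra)).
assert (hb : forall t, d <= t <= 2 * PI - d -> Rabs (- dh t) <= / m * (1 / (4 * c * c))).
{ intros t ht; specialize (hs t ht); unfold dh, Rdiv.
  rewrite Rabs_Ropp, Rabs_mult, Rinv_mult, Rabs_mult, (Rabs_pos_eq (/ m * _)).
  2: { apply Rlt_le, Rmult_lt_0_compat; [lra | apply Rinv_0_lt_compat; nra]. }
  assert (Rabs (cos (m * t + phi)) <= 1) by (apply Rabs_le; split; apply COS_bound).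
  assert (Rabs (cos (t * / 2)) <= 1) by (apply Rabs_le; split; apply COS_bound).
  assert (/ (4 * (sin (t * / 2) * sin (t * / 2))) <= / (4 * c * c))
    by (apply Rinv_le_contravar; unfold Rdiv in *; nra).
  assert (0 < / (4 * (sin (t * / 2) * sin (t * / 2))))
    by (apply Rinv_0_lt_compat; unfold Rdiv in *; nra).
  pose proof (Rabs_pos (cos (m * t + phi))); pose proof (Rabs_pos (cos (t * / 2))).
  rewrite <- (Rmult_1_l (/ m * (1 * _))).
  apply Rmult_le_compat; [nra | nra | nra | apply Rmult_le_compat_l; lra]. }
specialize (hosc (fun t ht => conj (hder t ht) (hb t ht))).
pose proof (hh x hx) as hhx; pose proof (hh PI ltac:(lra)) as hhpi.
assert (hle : / m * K <= e / 2).
{ apply Rle_trans with (e / 2 / K * K); [apply Rmult_le_compat_r; lra|].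
  apply Req_le; field; lra. }
assert (hbd : / m * (1 / (4 * c * c)) * (2 * PI - d - d) <= / m * (1 / (4 * c * c) * (2 * PI))).
{ rewrite Rmult_assoc; apply Rmult_le_compat_l; [lra|].
  apply Rmult_le_compat_l; [apply Rlt_le, Rdiv_lt_0_compat; nra | lra]. }
unfold K in hle; rewrite Rmult_plus_distr_l in hle.
assert (hcc : / m * / (2 * c) + / m * / (2 * c) = / m * (1 / c)) by (field; lra).
cbv beta in hosc.
apply Rabs_lt_between in h0; apply Rabs_le_between in hosc.
apply Rabs_le_between in hhx; apply Rabs_le_between in hhpi.
apply Rabs_le; lra.
Qed.

(** * Recurrences for the even zeta values *)

(* Coquelicot's sums leave equations typed in a canonical structure over [R],
   which [ring] and [field] do not recognise. *)
Ltac in_R := match goal with |- ?a = ?b => change (a = b :> R) end.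

(* [appell a (S s)] is the primitive of [appell a s] with value [a (S s)] at [0]. *)
Definition appell (a : nat -> R) (s : nat) (x : R) : R :=
  sum_n (fun j => a j * x ^ (s - j) / INR (fact (s - j))) s.

Lemma appell_derive (a : nat -> R) (s : nat) (x : R) :
  is_derive (appell a (S s)) x (appell a s x).
Proof.
apply is_derive_ext with (f := fun y =>
  sum_n (fun j => a j * y ^ (S s - j) / INR (fact (S s - j))) s + a (S s)).
{ intros y; unfold appell; rewrite sum_Sn, Nat.sub_diag; simpl (fact 0); simpl (y ^ 0).
  rewrite INR_1; change plus with Rplus.
  rewrite Rdiv_1_r, Rmult_1_r; reflexivity. }
rewrite <- (Rplus_0_r (appell a s x)).
apply @is_derive_plus; [|apply @is_derive_const].
apply (is_derive_sum_n (fun j y => a j * y ^ (S s - j) / INR (fact (S s - j)))).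
intros j hj; replace (S s - j)%nat with (S (s - j)) by lia.
pose proof (INR_fact_neq_0 (s - j)); pose proof (INR_S_pos (s - j)).
rewrite fact_simpl, mult_INR; set (f := INR (fact (s - j))) in *.
set (c := INR (S (s - j))) in *.
evar_last; [auto_derive; [trivial | reflexivity]|].
change (match (s - j)%nat with 0%nat => 1 | S _ => INR (s - j) + 1 end) with c.
simpl pred; field; lra.
Qed.

Lemma appell_continuous (a : nat -> R) (s : nat) (x : R) : continuous (appell a s) x.
Proof.
destruct s as [|s].
- apply continuous_ext with (f := fun _ => a 0%nat); [|apply continuous_const].
  intros y; unfold appell; rewrite sum_O; simpl; field.
- apply (ex_derive_continuous (appell a (S s))); eexists; apply appell_derive.
Qed.

Lemma appell_0 (a : nat -> R) (s : nat) : appell a s 0 = a s.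
Proof.
destruct s as [|s]; unfold appell.
- rewrite sum_O; simpl; field.
- rewrite sum_Sn, Nat.sub_diag.
  rewrite (sum_n_ext_loc _ (fun _ => 0)).
  + rewrite sum_n_const; change plus with Rplus; simpl (fact 0); simpl (0 ^ 0); rewrite INR_1; field.
  + intros j hj; replace (S s - j)%nat with (S (s - j)) by lia.
    rewrite pow_i by lia; unfold Rdiv; in_R; ring.
Qed.

Definition fourier0 (j : nat) : R :=
  match j with
  | 0%nat => - (1 / 2)
  | 1%nat => PI / 2
  | _ => cos (INR j * (PI / 2)) * zeta (INR j)
  end.

Lemma cos_sub_PI2_n (n : nat) : cos (INR n * PI - PI / 2) = 0.
Proof.
rewrite cos_minus, cos_PI2, (sin_eq_0_1 (INR n * PI)); [ring|].
exists (Z.of_nat n); now rewrite INR_IZR_INZ.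
Qed.

Lemma converges_inside_ext (b : R) (f : nat -> R -> R) (g h : R -> R) :
  (forall x, 0 < x < b -> g x = h x) -> converges_inside b f g -> converges_inside b f h.
Proof.
intros hgh hU d e hd he; destruct (hU d e hd he) as [N0 h0]; exists N0.
intros N x hN hx; rewrite <- hgh by lra; now apply h0.
Qed.

Lemma converges_inside_sub (b b' : R) (f : nat -> R -> R) (g : R -> R) :
  b' <= b -> converges_inside b f g -> converges_inside b' f g.
Proof.
intros hb hU d e hd he; destruct (hU d e hd he) as [N0 h0]; exists N0.
intros N x hN hx; apply h0; [exact hN | lra].
Qed.

Lemma sine_series_appell (s : nat) : (1 <= s)%nat ->
  converges_inside (2 * PI) (trig_sum 0 s) (appell fourier0 s).
Proof.
pose proof PI_RGT_0 as hPI.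
induction s as [|s IH]; [lia|]; intros _; destruct s as [|s].
- apply converges_inside_base.
  + intros x hx; evar_last; [apply appell_derive|].
    assert (0 < sin (x / 2)) by (apply sin_gt_0; lra).
    rewrite Rplus_0_r; unfold appell; rewrite sum_O; simpl; field; lra.
  + apply is_lim_seq_ext with (u := fun _ => 0).
    * intros N; unfold trig_sum; rewrite (sum_n_ext _ (fun _ => 0)).
      { rewrite sum_n_const; ring. }
      intros n; unfold trig_term.
      replace (INR (S n) * PI - INR 1 * (PI / 2) + 0) with (INR (S n) * PI - PI / 2)
        by (simpl (INR 1); ring).
      rewrite cos_sub_PI2_n; unfold Rdiv; in_R; ring.
    * replace (appell fourier0 1 PI) with 0; [apply is_lim_seq_const|].
      unfold appell; rewrite sum_Sn, sum_O; change plus with Rplus; simpl; field.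
- apply (converges_inside_primitive 0 _ (S s) (appell fourier0 (S s))).
  + lra.
  + lia.
  + apply IH; lia.
  + intros x _; apply appell_derive.
  + replace (cos _ * zeta _) with (appell fourier0 (S (S s)) 0).
    * apply (filterlim_filter_le_1 (F := locally 0)); [apply filter_le_within|].
      apply appell_continuous.
    * rewrite appell_0; unfold fourier0; f_equal.
      rewrite <- cos_neg; f_equal; ring.
Qed.

Lemma appell_fourier0_2PI (s : nat) : (2 <= s)%nat ->
  appell fourier0 s (2 * PI) = fourier0 s.
Proof.
intros hs; pose proof PI_RGT_0 as hPI.
rewrite <- (appell_0 fourier0 s).
assert (hpt : forall x, 0 < x < 2 * PI -> trig_series 0 s x = appell fourier0 s x).
{ intros x hx; apply converges_inside_eq with (2 * PI);
    [exact hs | apply sine_series_appell; lia | exact hx]. }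
assert (heq : forall (F : (R -> Prop) -> Prop) (a : R), ProperFilter' F ->
  filter_le F (locally a) -> F (fun x => 0 < x < 2 * PI) ->
  appell fourier0 s a = trig_series 0 s a).
{ intros F a hF hle hF2.
  apply (filterlim_locally_unique (F := F) (appell fourier0 s)).
  - apply (filterlim_filter_le_1 (F := locally a) _ hle), appell_continuous.
  - apply filterlim_ext_loc with (f := trig_series 0 s).
    + revert hF2; apply filter_imp, hpt.
    + apply (filterlim_filter_le_1 (F := locally a) _ hle), (trig_series_continuous 0 s a hs). }
assert (hb : 0 < 2 * PI) by lra.
rewrite (heq (at_left (2 * PI)) (2 * PI)), (heq (at_right 0) 0).
- apply trig_series_2PI.
- apply Proper_StrongProper, at_right_proper_filter.
- apply filter_le_within.
- exists (mkposreal _ hb); intros y hy hy0; change (Rabs (y - 0) < 2 * PI) in hy.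
  apply Rabs_lt_between in hy; lra.
- apply Proper_StrongProper, at_left_proper_filter.
- apply filter_le_within.
- exists (mkposreal _ hb); intros y hy hy0; change (Rabs (y - 2 * PI) < 2 * PI) in hy.
  apply Rabs_lt_between in hy; lra.
Qed.

(* [bern_coef k = B_(2k) (-1)^k / (2k)!], the coefficient of [x^(2k)] in [(x/2) cot (x/2)]. *)
Definition bern_coef (k : nat) : R :=
  match k with
  | 0%nat => 1
  | _ => - (2 * zeta (INR (2 * k)) / (2 * PI) ^ (2 * k))
  end.

Lemma cos_INR_PI (k : nat) : cos (INR k * PI) = (-1) ^ k.
Proof.
induction k as [|k IH]; [now rewrite Rmult_0_l, cos_0|].
replace (INR (S k) * PI) with (INR k * PI + PI) by (rewrite S_INR; ring).
rewrite neg_cos, IH; simpl; ring.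
Qed.

Lemma fourier0_even (k : nat) :
  fourier0 (2 * k) = - (1 / 2) * (-1) ^ k * (2 * PI) ^ (2 * k) * bern_coef k.
Proof.
destruct k as [|k]; [simpl; field|].
replace (fourier0 (2 * S k)) with (cos (INR (2 * S k) * (PI / 2)) * zeta (INR (2 * S k)))
  by now replace (2 * S k)%nat with (S (S (2 * k))) by lia.
replace (INR (2 * S k) * (PI / 2)) with (INR (S k) * PI) by (rewrite mult_INR; simpl (INR 2); field).
rewrite cos_INR_PI; unfold bern_coef; field.
apply pow_nonzero; pose proof PI_RGT_0; lra.
Qed.

Lemma fourier0_odd (k : nat) : (1 <= k)%nat -> fourier0 (2 * k + 1) = 0.
Proof.
intros hk; replace (fourier0 (2 * k + 1))
  with (cos (INR (2 * k + 1) * (PI / 2)) * zeta (INR (2 * k + 1)))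
  by now replace (2 * k + 1)%nat with (S (S (2 * k - 1))) by lia.
replace (INR (2 * k + 1) * (PI / 2)) with (INR (S k) * PI - PI / 2).
- rewrite cos_sub_PI2_n; ring.
- rewrite plus_INR, mult_INR, S_INR; simpl (INR 2); simpl (INR 1); field.
Qed.

Lemma sum_n_even_odd (f : nat -> R) (m : nat) :
  sum_n f (2 * m + 1) = sum_n (fun j => f (2 * j)%nat) m + sum_n (fun j => f (2 * j + 1)%nat) m.
Proof.
induction m as [|m IH].
- replace (2 * 0 + 1)%nat with 1%nat by lia; rewrite sum_Sn, !sum_O; reflexivity.
- replace (2 * S m + 1)%nat with (S (S (2 * m + 1))) by lia.
  rewrite !sum_Sn, IH; change plus with Rplus.
  replace (S (S (2 * m + 1)))%nat with (2 * S m + 1)%nat by lia.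
  replace (S (2 * m + 1)) with (2 * S m)%nat by lia; in_R; ring.
Qed.

Lemma sum_n_single (f : nat -> R) (m : nat) :
  (forall j, (1 <= j)%nat -> f j = 0) -> sum_n f m = f 0%nat.
Proof.
intros hf; induction m as [|m IH]; [apply sum_O|].
rewrite sum_Sn, IH, (hf (S m)) by lia; apply Rplus_0_r.
Qed.

Lemma bern_coef_rec_odd (m : nat) : (1 <= m)%nat ->
  sum_n (fun j => (-1) ^ j * bern_coef j / INR (fact (2 * (m - j) + 1))) m
  = 1 / 2 / INR (fact (2 * m)).
Proof.
intros hm; pose proof PI_RGT_0 as hPI.
pose proof (appell_fourier0_2PI (2 * m + 1) ltac:(lia)) as h.
rewrite fourier0_odd in h by exact hm.
unfold appell in h; rewrite sum_n_even_odd in h.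
rewrite (sum_n_single (fun j => fourier0 (2 * j + 1) * _ / _)) in h.
2: { intros j hj; rewrite fourier0_odd by exact hj; unfold Rdiv; in_R; ring. }
replace (2 * m + 1 - (2 * 0 + 1))%nat with (2 * m)%nat in h by lia.
rewrite (sum_n_ext_loc _ (fun j => (- (1 / 2) * (2 * PI) ^ (2 * m + 1)) *
  ((-1) ^ j * bern_coef j / INR (fact (2 * (m - j) + 1))))) in h.
2: { intros j hj; rewrite fourier0_even.
  replace (2 * m + 1 - 2 * j)%nat with (2 * (m - j) + 1)%nat by lia.
  replace (2 * m + 1)%nat with (2 * j + (2 * (m - j) + 1))%nat by lia.
  rewrite (pow_add (2 * PI) (2 * j)); in_R; field; apply INR_fact_neq_0. }
rewrite (sum_n_mult_l (K := R_Ring)) in h; change mult with Rmult in h.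
simpl (fourier0 (2 * 0 + 1)) in h; rewrite pow_add, pow_1 in h.
assert (hp : (2 * PI) ^ (2 * m) <> 0) by (apply pow_nonzero; lra).
pose proof (INR_fact_neq_0 (2 * m)).
set (S := sum_n _ m) in *; set (p := (2 * PI) ^ (2 * m)) in *.
apply Rmult_eq_reg_l with (p * PI); [|apply Rmult_integral_contrapositive_currified; lra].
apply Rminus_diag_uniq.
replace 0 with (- (- (1 / 2) * (p * (2 * PI)) * S + PI / 2 * p / INR (fact (2 * m)))) by lra.
field; lra.
Qed.

Lemma bern_coef_rec_even (m : nat) :
  sum_n (fun j => (-1) ^ j * bern_coef j / INR (fact (2 * (m - j) + 2))) m
  = 1 / 2 / INR (fact (2 * m + 1)).
Proof.
pose proof PI_RGT_0 as hPI.
pose proof (appell_fourier0_2PI (2 * m + 2) ltac:(lia)) as h.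
unfold appell in h; replace (2 * m + 2)%nat with (S (2 * m + 1)) in h by lia.
rewrite sum_Sn, Nat.sub_diag in h; change plus with Rplus in h.
simpl (fact 0) in h; simpl (_ ^ 0) in h; rewrite INR_1, Rdiv_1_r, Rmult_1_r in h.
rewrite sum_n_even_odd in h.
rewrite (sum_n_single (fun j => fourier0 (2 * j + 1) * _ / _)) in h.
2: { intros j hj; rewrite fourier0_odd by exact hj; unfold Rdiv; in_R; ring. }
replace (S (2 * m + 1) - (2 * 0 + 1))%nat with (2 * m + 1)%nat in h by lia.
rewrite (sum_n_ext_loc _ (fun j => (- (1 / 2) * (2 * PI) ^ (2 * m + 2)) *
  ((-1) ^ j * bern_coef j / INR (fact (2 * (m - j) + 2))))) in h.
2: { intros j hj; rewrite fourier0_even.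
  replace (S (2 * m + 1) - 2 * j)%nat with (2 * (m - j) + 2)%nat by lia.
  replace (2 * m + 2)%nat with (2 * j + (2 * (m - j) + 2))%nat by lia.
  rewrite (pow_add (2 * PI) (2 * j)); in_R; field; apply INR_fact_neq_0. }
rewrite (sum_n_mult_l (K := R_Ring)) in h; change mult with Rmult in h.
simpl (fourier0 (2 * 0 + 1)) in h.
replace (2 * m + 2)%nat with (S (2 * m + 1)) in h by lia; rewrite <- tech_pow_Rmult in h.
assert (hp : (2 * PI) ^ (2 * m + 1) <> 0) by (apply pow_nonzero; lra).
pose proof (INR_fact_neq_0 (2 * m + 1)).
set (S := sum_n _ m) in *; set (p := (2 * PI) ^ (2 * m + 1)) in *.
apply Rmult_eq_reg_l with (p * PI); [|apply Rmult_integral_contrapositive_currified; lra].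
apply Rminus_diag_uniq.
replace 0 with (- (- (1 / 2) * (2 * PI * p) * S + PI / 2 * p / INR (fact (2 * m + 1)))) by lra.
field; lra.
Qed.

Lemma bern_coef_bernoulli (B : nat -> R) : is_bernoulli_star B ->
  forall k, (1 <= k)%nat -> B k = - (INR (fact (2 * k)) * bern_coef k).
Proof.
intros hB; apply (is_bernoulli_star_unique _ _ hB); clear B hB.
intros s hs.
set (f := fun j => (-1) ^ j * bern_coef j * (INR (2 * j) / INR (fact (2 * (s - j) + 2)))).
assert (hf : sum_n f s = 1 / 2 / INR (fact (2 * s + 1))).
{ rewrite (sum_n_ext_loc _ (fun j => plus
    (mult (INR (2 * s + 2)) ((-1) ^ j * bern_coef j / INR (fact (2 * (s - j) + 2))))
    (mult (-1) ((-1) ^ j * bern_coef j / INR (fact (2 * (s - j) + 1)))))).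
  - rewrite sum_n_plus, !(sum_n_mult_l (K := R_Ring)).
    rewrite bern_coef_rec_odd, bern_coef_rec_even by exact hs.
    change (INR (2 * s + 2) * (1 / 2 / INR (fact (2 * s + 1))) + -1 * (1 / 2 / INR (fact (2 * s)))
      = 1 / 2 / INR (fact (2 * s + 1))).
    replace (2 * s + 1)%nat with (S (2 * s)) by lia.
    replace (2 * s + 2)%nat with (S (S (2 * s))) by lia.
    rewrite fact_simpl, mult_INR, (S_INR (S (2 * s))).
    field; split; [apply INR_fact_neq_0 | apply not_0_INR; lia].
  - intros j hj; unfold f; change plus with Rplus; change mult with Rmult; in_R.
    replace (2 * (s - j) + 2)%nat with (S (2 * (s - j) + 1)) by lia.
    replace (INR (2 * j)) with (INR (2 * s + 2) - INR (S (2 * (s - j) + 1))).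
    + rewrite fact_simpl, mult_INR; field; split; [apply INR_fact_neq_0 | apply not_0_INR; lia].
    + rewrite <- minus_INR by lia; f_equal; lia. }
unfold sum_n in hf; rewrite sum_Sn_m in hf by lia.
replace (f 0%nat) with 0 in hf by (unfold f; simpl; unfold Rdiv; in_R; ring).
change plus with Rplus in hf; rewrite Rplus_0_l in hf.
replace s with (S (s - 1)) in hf at 1 by lia; rewrite <- sum_n_m_S in hf.
rewrite (sum_n_m_ext_loc _ (fun k => mult (INR (fact (2 * s + 1))) (f (S k)))).
- rewrite (sum_n_m_mult_l (K := R_Ring)).
  change (INR (fact (2 * s + 1)) * sum_n_m (fun k => f (S k)) 0 (s - 1) = 1 / 2); rewrite hf.
  field; apply INR_fact_neq_0.
- intros k hk; unfold f, Binomial.C; change mult with Rmult; in_R.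
  replace (k + 1)%nat with (S k) by lia.
  replace (2 * s + 1 - (2 * k + 1))%nat with (2 * (s - S k) + 2)%nat by lia.
  replace (2 * S k)%nat with (S (2 * k + 1)) by lia.
  rewrite fact_simpl, mult_INR; simpl ((-1) ^ S k).
  field; split; apply INR_fact_neq_0.
Qed.

(** * Power series of the cotangent and of the logarithm of the sine *)

Lemma CV_radius_ge (a : nat -> R) (r M : R) :
  (forall n, Rabs (a n * r ^ n) <= M) -> Rbar_le r (CV_radius a).
Proof. intros h; apply (proj1 (CV_radius_bounded a)); now exists M. Qed.

Lemma CV_radius_entire (a : nat -> R) (x : R) :
  (forall u, ex_pseries a u) -> Rbar_lt x (CV_radius a).
Proof.
intros h; apply Rbar_not_le_lt; intros hle.
apply (CV_disk_outside a (Rabs x + 1)).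
- apply Rbar_le_lt_trans with (1 := hle); simpl.
  pose proof (Rle_abs x); pose proof (Rle_abs (Rabs x + 1)); lra.
- apply (ex_series_lim_0 (fun n => a n * (Rabs x + 1) ^ n)).
  now apply ex_pseries_R.
Qed.

Lemma is_pseries_sin_n (u : R) : is_pseries sin_n u (proj1_sig (exist_sin u)).
Proof. apply is_pseries_Reals; exact (proj2_sig (exist_sin u)). Qed.

Lemma is_pseries_cos_n (u : R) : is_pseries cos_n u (proj1_sig (exist_cos u)).
Proof. apply is_pseries_Reals; exact (proj2_sig (exist_cos u)). Qed.

Lemma sin_PSeries (x : R) : sin x = x * PSeries sin_n (x ^ 2).
Proof.
rewrite <- Rsqr_pow2, (is_pseries_unique _ _ _ (is_pseries_sin_n (Rsqr x))).
unfold sin; now destruct (exist_sin (Rsqr x)).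
Qed.

Lemma cos_PSeries (x : R) : cos x = PSeries cos_n (x ^ 2).
Proof.
rewrite <- Rsqr_pow2, (is_pseries_unique _ _ _ (is_pseries_cos_n (Rsqr x))).
unfold cos; now destruct (exist_cos (Rsqr x)).
Qed.

Lemma zeta_bound (j : nat) : (2 <= j)%nat -> Rabs (zeta (INR j)) <= 2.
Proof.
intros hj; rewrite zeta_INR.
pose proof (series_tail_bound (fun n => / INR (S n) ^ j) 0) as h.
rewrite sum_O, INR_1, pow1, Rinv_1 in h.
assert (h' := h (fun n => ltac:(destruct (inv_pow_ge2 j n hj); rewrite Rabs_pos_eq; lra))).
apply Rabs_le_between in h'; apply Rabs_le; lra.
Qed.

Lemma bern_coef_bound (k : nat) : Rabs (bern_coef k * (2 * PI) ^ (2 * k)) <= 4.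
Proof.
destruct k as [|k].
- simpl; rewrite Rmult_1_r, Rabs_R1; lra.
- unfold bern_coef; pose proof PI_RGT_0.
  replace (_ * _) with (-2 * zeta (INR (2 * S k))) by (field; apply pow_nonzero; lra).
  pose proof (zeta_bound (2 * S k) ltac:(lia)).
  rewrite Rabs_mult, (Rabs_left (-2)) by lra; lra.
Qed.

Lemma bern_coef_radius (x : R) : Rabs x < 2 * PI -> Rbar_lt (Rabs (x ^ 2)) (CV_radius bern_coef).
Proof.
intros hx; pose proof (Rabs_pos x).
apply Rbar_lt_le_trans with (Finite ((2 * PI) ^ 2)).
- change (Rabs (x ^ 2) < (2 * PI) ^ 2); rewrite <- RPow_abs; nra.
- apply CV_radius_ge with 4; intros n; rewrite <- pow_mult; apply bern_coef_bound.
Qed.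

Lemma bern_coef_mult_sin (x : R) : Rabs x < 2 * PI ->
  PSeries bern_coef (x ^ 2) * sin x = x / 2 * (1 + cos x).
Proof.
intros hx; rewrite sin_PSeries, cos_PSeries.
assert (hs := CV_radius_entire sin_n (Rabs (x ^ 2))
  (fun u => ex_intro _ _ (is_pseries_sin_n u))).
rewrite <- (Rmult_assoc _ x), (Rmult_comm _ x), Rmult_assoc.
rewrite <- (PSeries_mult _ _ _ (bern_coef_radius x hx) hs).
enough (PSeries (PS_mult bern_coef sin_n) (x ^ 2) = (1 + PSeries cos_n (x ^ 2)) / 2)
  as -> by field.
assert (hcoef : forall n, PS_mult bern_coef sin_n (S n) = 1 / 2 * cos_n (S n)).
{ intros n; unfold PS_mult, cos_n; rewrite <- sum_n_Reals.
  rewrite (sum_n_ext_loc _ (fun j => mult ((-1) ^ S n)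
    ((-1) ^ j * bern_coef j / INR (fact (2 * (S n - j) + 1))))).
  - rewrite (sum_n_mult_l (K := R_Ring)), bern_coef_rec_odd by lia.
    change mult with Rmult; field; apply INR_fact_neq_0.
  - intros j hj; unfold sin_n; change mult with Rmult; in_R.
    replace ((-1) ^ (S n - j)) with ((-1) ^ S n * (-1) ^ j); [field; apply INR_fact_neq_0|].
    replace (S n) with (S n - j + j)%nat at 1 by lia.
    rewrite pow_add, Rmult_assoc, <- Rpow_mult_distr.
    replace (-1 * -1) with 1 by ring; rewrite pow1; ring. }
assert (hprod := ex_pseries_mult _ _ _ (bern_coef_radius x hx) hs).
rewrite (PSeries_decr_1 _ _ hprod).
rewrite (PSeries_decr_1 cos_n) by (eexists; apply is_pseries_cos_n).
rewrite (PSeries_ext (PS_decr_1 (PS_mult bern_coef sin_n)) (PS_scal (1 / 2) (PS_decr_1 cos_n)))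
  by exact hcoef.
rewrite PSeries_scal.
replace (PS_mult bern_coef sin_n 0) with 1 by (unfold PS_mult, sin_n; simpl; field).
replace (cos_n 0) with 1 by (unfold cos_n; simpl; field).
field.
Qed.

(* Power series coefficients of [- ln (sin (x / 2) / (x / 2))]. *)
Definition log_coef (i : nat) : R :=
  if Nat.even i then
    match i with 0%nat => 0 | _ => - bern_coef (Nat.div2 i) / INR i end
  else 0.

Lemma log_coef_odd (k : nat) : log_coef (2 * k + 1) = 0.
Proof. unfold log_coef; now rewrite Nat.add_comm, Nat.even_add_mul_2. Qed.

Lemma log_coef_even (k : nat) : (1 <= k)%nat ->
  log_coef (2 * k) = - bern_coef k / INR (2 * k).
Proof.
intros hk; unfold log_coef; rewrite Nat.even_mul, Nat.div2_double; simpl orb.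
now destruct k as [|k]; [lia|].
Qed.

Lemma even_odd_ind (P : nat -> Prop) :
  (forall k, P (2 * k)%nat) -> (forall k, P (2 * k + 1)%nat) -> forall n, P n.
Proof.
intros h0 h1 n; destruct (Nat.Even_or_Odd n) as [[k ->]|[k ->]]; auto.
Qed.

Lemma log_coef_radius (x : R) : Rabs x < 2 * PI -> Rbar_lt (Rabs x) (CV_radius log_coef).
Proof.
intros hx; apply Rbar_lt_le_trans with (Finite (2 * PI)); [exact hx|].
apply CV_radius_ge with 4; apply even_odd_ind; intros k.
- destruct k as [|k]; [simpl; rewrite Rmult_0_l, Rabs_R0; lra|].
  rewrite log_coef_even by lia.
  replace (_ * _) with (bern_coef (S k) * (2 * PI) ^ (2 * S k) * - / INR (2 * S k))
    by (unfold Rdiv; ring).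
  assert (h1 : 1 <= INR (2 * S k)) by (apply (le_INR 1); lia).
  assert (0 < / INR (2 * S k) <= 1).
  { split; [apply Rinv_0_lt_compat; lra|].
    rewrite <- Rinv_1; apply Rinv_le_contravar; lra. }
  rewrite Rabs_mult, Rabs_Ropp, (Rabs_pos_eq (/ _)) by lra.
  pose proof (bern_coef_bound (S k)).
  pose proof (Rabs_pos (bern_coef (S k) * (2 * PI) ^ (2 * S k))); nra.
- rewrite log_coef_odd, Rmult_0_l, Rabs_R0; lra.
Qed.

Lemma PSeries_even (a : nat -> R) (x : R) :
  (forall k, a (2 * k + 1)%nat = 0) -> ex_pseries (fun k => a (2 * k)%nat) (x ^ 2) ->
  PSeries a x = PSeries (fun k => a (2 * k)%nat) (x ^ 2).
Proof.
intros ha he.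
assert (h0 : is_pseries (fun k => a (2 * k + 1)%nat) (x ^ 2) 0).
{ apply is_pseries_ext with (fun _ => 0); [now intros n|].
  evar_last; [apply PSeries_correct, CV_radius_inside; now rewrite CV_radius_const_0|].
  apply PSeries_const_0. }
rewrite PSeries_odd_even; [|exact he | now exists 0].
rewrite (is_pseries_unique _ _ _ h0); ring.
Qed.

Lemma log_coef_derive_PSeries (x : R) : Rabs x < 2 * PI ->
  x * PSeries (PS_derive log_coef) x = 1 - PSeries bern_coef (x ^ 2).
Proof.
intros hx; rewrite <- PSeries_incr_1.
pose proof (CV_radius_inside _ _ (bern_coef_radius x hx)) as hb.
assert (hcoef : forall k, PS_incr_1 (PS_derive log_coef) (2 * k)
  = match k with 0%nat => 0 | _ => - bern_coef k end).
{ intros k; destruct k as [|k]; [reflexivity|].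
  replace (2 * S k)%nat with (S (2 * k + 1)) by lia.
  change (INR (S (2 * k + 1)) * log_coef (S (2 * k + 1)) = - bern_coef (S k)).
  replace (S (2 * k + 1))%nat with (2 * S k)%nat by lia.
  rewrite log_coef_even by lia; field; apply not_0_INR; lia. }
assert (hex : ex_pseries (fun k => PS_incr_1 (PS_derive log_coef) (2 * k)) (x ^ 2)).
{ apply ex_pseries_ext with (PS_incr_1 (PS_opp (PS_decr_1 bern_coef))).
  - intros [|k]; rewrite hcoef; reflexivity.
  - apply ex_pseries_incr_1, ex_pseries_opp, CV_radius_inside.
    rewrite CV_radius_decr_1; now apply bern_coef_radius. }
rewrite PSeries_even; [|intros k | exact hex].
2: { rewrite Nat.add_1_r; change (INR (S (2 * k)) * log_coef (S (2 * k)) = 0).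
  rewrite <- Nat.add_1_r, log_coef_odd; ring. }
rewrite (PSeries_ext _ (PS_incr_1 (PS_opp (PS_decr_1 bern_coef))))
  by (intros [|k]; rewrite hcoef; reflexivity).
rewrite PSeries_incr_1, PSeries_opp, (PSeries_decr_1 bern_coef) by exact hb.
simpl (bern_coef 0); ring.
Qed.

(** * Iterated primitives of the cosine series *)

Lemma alternating_harmonic :
  is_lim_seq (fun N => sum_n (fun n => (-1) ^ S n / INR (S n)) N) (- ln 2).
Proof.
set (f := fun (N : nat) (t : R) => sum_n (fun n => (- t) ^ S n / INR (S n)) N + ln (1 + t)).
assert (hf : forall N t, 0 <= t <= 1 -> is_derive (f N) t ((- t) ^ S N / (1 + t))).
{ intros N t ht.
  replace ((- t) ^ S N / (1 + t)) with (plus (sum_n (fun n => - (- t) ^ n) N) (/ (1 + t))).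
  - apply @is_derive_plus.
    + apply (is_derive_sum_n (fun n y => (- y) ^ S n / INR (S n))); intros n _.
      pose proof (INR_S_pos n) as h; set (c := INR (S n)) in *.
      evar_last; [auto_derive; [trivial | reflexivity]|].
      change (match n with 0%nat => 1 | S _ => INR n + 1 end) with c.
      simpl pred; field; lra.
    + auto_derive; [lra | field; lra].
  - change plus with Rplus; induction N as [|N IH].
    + rewrite sum_O; simpl; field; lra.
    + rewrite sum_Sn; change plus with Rplus.
      replace (_ + _ + _) with ((- t) ^ S N / (1 + t) - (- t) ^ S N) by (rewrite <- IH; ring).
      simpl; field; lra. }
assert (hb : forall N, Rabs (f N 1 - f N 0) <= / INR (S N)).
{ intros N.
  apply Rle_trans with (1 ^ S (S N) / INR (S (S N)) - 0 ^ S (S N) / INR (S (S N))).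
  - apply (derive_dominated (f N) (fun t => (- t) ^ S N / (1 + t))
      (fun t => t ^ S (S N) / INR (S (S N))) (fun t => t ^ S N)); [lra | apply hf | |].
    + intros t _; pose proof (INR_S_pos (S N)) as h; set (c := INR (S (S N))) in *.
      evar_last; [auto_derive; [trivial | reflexivity]|].
      change (match N with 0%nat => 1 | S _ => INR N + 1 end + 1) with c; simpl pred; simpl pow; field; lra.
    + intros t ht; unfold Rdiv; rewrite Rabs_mult, <- RPow_abs, Rabs_Ropp.
      rewrite (Rabs_pos_eq t), (Rabs_pos_eq (/ _))
        by (try apply Rlt_le, Rinv_0_lt_compat; lra).
      assert (/ (1 + t) <= 1) by (rewrite <- Rinv_1; apply Rinv_le_contravar; lra).
      pose proof (pow_le t (S N) ltac:(lra)); nra.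
  - rewrite pow1, pow_i by lia; pose proof (INR_S_pos N).
    unfold Rdiv; rewrite Rmult_0_l, Rmult_1_l, Rminus_0_r.
    apply Rinv_le_contravar; [lra | apply le_INR; lia]. }
apply is_lim_seq_ext with (u := fun N => (f N 1 - f N 0) + - ln 2).
- intros N; unfold f.
  rewrite (sum_n_ext (fun n => (- 0) ^ S n / INR (S n)) (fun _ => 0)).
  2: { intros n; rewrite Ropp_0, pow_i by lia; unfold Rdiv; in_R; ring. }
  rewrite sum_n_const, Rplus_0_r, ln_1; replace (1 + 1) with 2 by ring.
  replace (- (1)) with (-1) by lra; ring.
- rewrite <- (Rplus_0_l (- ln 2)) at 1.
  apply is_lim_seq_plus'; [|apply is_lim_seq_const].
  apply is_lim_seq_abs_0.
  apply is_lim_seq_le_le with (u := fun _ => 0) (w := fun N => / INR (S N)).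
  + intros N; split; [apply Rabs_pos | apply hb].
  + apply is_lim_seq_const.
  + apply inv_INR_S_lim.
Qed.

Lemma cosine_series_log_sin :
  converges_inside (2 * PI) (trig_sum (PI / 2) 1) (fun x => - ln (2 * sin (x / 2))).
Proof.
apply converges_inside_base.
- intros x hx; assert (0 < sin (x / 2)) by (apply sin_gt_0; lra).
  rewrite (Rplus_comm (x / 2)), <- cos_sin.
  auto_derive; [unfold Rdiv in *; lra | unfold Rdiv in *; field; lra].
- rewrite sin_PI2, Rmult_1_r.
  apply is_lim_seq_ext with (2 := alternating_harmonic); intros N.
  apply sum_n_ext; intros n; unfold trig_term; rewrite pow_1; f_equal.
  rewrite <- cos_INR_PI; f_equal; simpl (INR 1); ring.
Qed.

Fixpoint PS_Int_iter (p : nat) (a : nat -> R) : nat -> R :=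
  match p with
  | 0%nat => a
  | S q => PS_Int (PS_Int_iter q a)
  end.

Lemma PS_Int_iter_radius (p : nat) (a : nat -> R) : CV_radius (PS_Int_iter p a) = CV_radius a.
Proof. induction p as [|p IH]; [reflexivity | now rewrite <- IH; apply CV_radius_Int]. Qed.

Lemma PS_derive_Int (a : nat -> R) (n : nat) : PS_derive (PS_Int a) n = a n.
Proof. unfold PS_derive, PS_Int; field; apply not_0_INR; lia. Qed.

(* The [p]-fold primitive of the expansion of [- ln (2 sin (x / 2))] at [0], normalised to
   tend to [0] there when [p >= 1]. *)
Definition log_sin_primitive (p : nat) (x : R) : R :=
  x ^ p / INR (fact p) * (harmonic p - ln x) + PSeries (PS_Int_iter p log_coef) x.

Lemma harmonic_S (p : nat) : harmonic (S p) = harmonic p + / INR (S p).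
Proof. unfold harmonic; rewrite sum_n_Sm by lia; reflexivity. Qed.

Lemma log_sin_primitive_derive (p : nat) (x : R) : 0 < x < 2 * PI ->
  is_derive (log_sin_primitive (S p)) x (log_sin_primitive p x).
Proof.
intros hx; unfold log_sin_primitive.
apply @is_derive_plus.
- rewrite harmonic_S, fact_simpl, mult_INR.
  pose proof (INR_fact_neq_0 p) as hf; pose proof (INR_S_pos p) as hp.
  set (c := INR (S p)) in *; set (f := INR (fact p)) in *; set (h := harmonic p).
  clearbody f h.
  evar_last; [auto_derive; [lra | reflexivity]|].
  change (match p with 0%nat => 1 | S _ => INR p + 1 end) with c.
  simpl pred; simpl pow; field; lra.
- rewrite (PSeries_ext (PS_Int_iter p log_coef) (PS_derive (PS_Int_iter (S p) log_coef)))
    by (intros n; symmetry; apply PS_derive_Int).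
  apply is_derive_PSeries; rewrite PS_Int_iter_radius.
  apply log_coef_radius; rewrite Rabs_pos_eq; lra.
Qed.

Lemma log_coef_PSeries_lim0 (p : nat) :
  filterlim (PSeries (PS_Int_iter p log_coef)) (at_right 0) (locally 0).
Proof.
replace 0 with (PSeries (PS_Int_iter p log_coef) 0) at 2.
- apply (filterlim_filter_le_1 (F := locally 0)); [apply filter_le_within|].
  apply continuity_pt_filterlim, PSeries_continuity.
  rewrite PS_Int_iter_radius; apply log_coef_radius; rewrite Rabs_R0.
  pose proof PI_RGT_0; lra.
- rewrite PSeries_0; now destruct p.
Qed.

Lemma x_ln_x_lim0 : filterlim (fun x => x * ln x) (at_right 0) (locally 0).
Proof.
apply filterlim_locally; intros e; pose proof (cond_pos e) as he.
assert (hd : 0 < Rmin 1 (e / 4 * (e / 4))) by (apply Rmin_glb_lt; nra).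
exists (mkposreal _ hd); intros x hx hx0; change (Rabs (x - 0) < Rmin 1 (e / 4 * (e / 4))) in hx.
change (Rabs (x * ln x - 0) < e).
rewrite Rminus_0_r in *; rewrite Rabs_pos_eq in hx by lra.
pose proof (Rmin_l 1 (e / 4 * (e / 4))); pose proof (Rmin_r 1 (e / 4 * (e / 4))).
set (y := sqrt x); assert (hy : 0 < y) by (apply sqrt_lt_R0; lra).
assert (hyx : x = y * y) by (symmetry; apply sqrt_sqrt; lra).
assert (hye : y < e / 4) by nra.
rewrite hyx, ln_mult by lra.
(* [ln (1 / y) <= 1 / y - 1] *)
assert (hln : - ln y <= / y).
{ rewrite <- ln_Rinv by lra; pose proof (Rinv_0_lt_compat y hy) as hi.
  pose proof (exp_ineq1_le (ln (/ y))) as h; rewrite exp_ln in h by lra; lra. }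
assert (hln0 : ln y <= 0).
{ rewrite <- ln_1; destruct (Rle_lt_or_eq_dec y 1) as [hl | hl]; [nra | left; apply ln_increasing; lra | rewrite hl; lra]. }
assert (hm : y * - ln y <= 1).
{ apply Rle_trans with (y * / y); [apply Rmult_le_compat_l; lra | apply Req_le; field; lra]. }
apply Rabs_def1; nra.
Qed.

Lemma log_sin_primitive_lim0 (p : nat) :
  filterlim (log_sin_primitive (S p)) (at_right 0) (locally 0).
Proof.
set (h := fun x : R => - (x ^ p / INR (fact (S p)))).
apply filterlim_ext with (f := fun x => plus
  (plus (x ^ S p / INR (fact (S p)) * harmonic (S p)) (mult (h x) (x * ln x)))
  (PSeries (PS_Int_iter (S p) log_coef) x)).
{ intros x; unfold log_sin_primitive, h; change plus with Rplus; change mult with Rmult.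
  rewrite <- (tech_pow_Rmult x p); in_R; field; apply INR_fact_neq_0. }
assert (hc : forall k (c : R), filterlim (fun x : R => x ^ k * c) (at_right 0) (locally (0 ^ k * c))).
{ intros k c; apply (filterlim_filter_le_1 (F := locally 0)); [apply filter_le_within|].
  apply (ex_derive_continuous (fun x : R => x ^ k * c)); auto_derive; trivial. }
replace (locally 0) with (locally (plus (plus (0 ^ S p * (/ INR (fact (S p)) * harmonic (S p)))
  (mult (0 ^ p * - / INR (fact (S p))) 0)) 0)).
2: { f_equal; change plus with Rplus; change mult with Rmult; rewrite pow_i by lia; in_R; ring. }
eapply filterlim_comp_2; [| apply log_coef_PSeries_lim0 | apply (filterlim_plus (V := R_NormedModule))].
eapply filterlim_comp_2; [| | apply (filterlim_plus (V := R_NormedModule))].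
- eapply filterlim_ext; [|apply hc]; intros x; simpl; unfold Rdiv; ring.
- eapply filterlim_comp_2; [| apply x_ln_x_lim0 | apply (filterlim_mult (K := R_AbsRing))].
  eapply filterlim_ext; [|apply hc]; intros x; unfold h, Rdiv; simpl; ring.
Qed.

Lemma log_sin_primitive_0 (x : R) : 0 < x < PI ->
  log_sin_primitive 0 x = - ln (2 * sin (x / 2)).
Proof.
intros hx; revert x hx.
enough (h : forall x, 0 < x < PI -> log_sin_primitive 0 x + ln (2 * sin (x / 2)) = 0)
  by (intros x hx; specialize (h x hx); lra).
pose proof PI_RGT_0 as hPI.
apply const_eq_right_limit; [exact hPI | |].
- assert (hder : forall t, 0 < t < PI ->
    is_derive (fun y => log_sin_primitive 0 y + ln (2 * sin (y / 2))) t 0).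
  { intros t ht.
    assert (hs2 : 0 < sin (t / 2)) by (apply sin_gt_0; lra).
    assert (hc2 : 0 < cos (t / 2)) by (apply cos_gt_0; lra).
    assert (htpi : Rabs t < 2 * PI) by (rewrite Rabs_pos_eq; lra).
    replace 0 with (plus (plus (- / t) (PSeries (PS_derive log_coef) t))
      (cos (t / 2) / (2 * sin (t / 2)))).
    - apply @is_derive_plus; [apply @is_derive_plus|].
      + unfold harmonic; rewrite sum_n_m_zero by lia; change zero with 0.
        simpl; auto_derive; [lra | field; lra].
      + apply is_derive_PSeries, log_coef_radius, htpi.
      + auto_derive; [unfold Rdiv in *; lra | unfold Rdiv in *; field; lra].
    - change plus with Rplus.
      pose proof (log_coef_derive_PSeries t htpi) as h1.
      pose proof (bern_coef_mult_sin t htpi) as h2.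
      replace (sin t) with (2 * sin (t / 2) * cos (t / 2)) in h2
        by (rewrite <- sin_2a; f_equal; field).
      replace (cos t) with (2 * cos (t / 2) * cos (t / 2) - 1) in h2
        by (rewrite <- cos_2a_cos; f_equal; field).
      set (W := PSeries bern_coef (t ^ 2)) in *.
      set (P := PSeries (PS_derive log_coef) t) in *.
      replace P with ((1 - W) / t) by (rewrite <- h1; field; lra).
      assert (hW : 2 * sin (t / 2) * W = t * cos (t / 2)).
      { apply Rmult_eq_reg_r with (cos (t / 2)); [|lra].
        replace (2 * sin (t / 2) * W * cos (t / 2)) with (W * (2 * sin (t / 2) * cos (t / 2))) by ring.
        rewrite h2; field. }
      replace W with (t * cos (t / 2) / (2 * sin (t / 2))) by (rewrite <- hW; field; lra).
      in_R; field; lra. }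
  intros x y hx hy; symmetry; apply Rminus_diag_uniq, Rabs_eq_0.
  apply Rle_antisym; [|apply Rabs_pos].
  rewrite <- (Rmult_0_l (Rmax x y - Rmin x y)).
  pose proof (Rmin_l x y); pose proof (Rmin_r x y).
  pose proof (Rmax_l x y); pose proof (Rmax_r x y).
  apply (small_oscillation_sym (fun z => log_sin_primitive 0 z + ln (2 * sin (z / 2))) (fun _ => 0)); [lra | lra |].
  intros t ht; split; [apply hder | rewrite Rabs_R0; lra].
  assert (0 < Rmin x y) by (apply Rmin_glb_lt; lra).
  assert (Rmax x y < PI) by (apply Rmax_lub_lt; lra); lra.
- apply filterlim_ext_loc with (f := fun x =>
    plus (PSeries (PS_Int_iter 0 log_coef) x) (ln (sin (x / 2) / (x / 2)))).
  { exists (mkposreal _ hPI); intros x hx hx0; change (Rabs (x - 0) < PI) in hx.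
    apply Rabs_lt_between in hx.
    assert (0 < sin (x / 2)) by (apply sin_gt_0; lra).
    unfold log_sin_primitive, harmonic; rewrite sum_n_m_zero by lia.
    change plus with Rplus; change zero with 0; simpl (x ^ 0); simpl (fact 0); rewrite INR_1.
    replace (sin (x / 2) / (x / 2)) with (2 * sin (x / 2) / x) by (field; lra).
    rewrite ln_div by lra; in_R; field. }
  replace (locally 0) with (locally (plus 0 0)) by (f_equal; apply Rplus_0_r).
  eapply filterlim_comp_2; [apply log_coef_PSeries_lim0 | |
    apply (filterlim_plus (V := R_NormedModule))].
  assert (hln : continuous ln 1) by (apply (ex_derive_continuous ln); auto_derive; lra).
  unfold continuous in hln; rewrite ln_1 in hln.
  apply (filterlim_comp _ _ _ (fun x => sin (x / 2) / (x / 2)) ln _ (locally 1)).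
  + apply (filterlim_comp _ _ _ (fun x => x / 2) (fun y => sin y / y) _ (locally' 0)).
    * intros P [d hP]; exists d; intros y hy hy0; apply hP.
      -- change (Rabs (y - 0) < d) in hy; change (Rabs (y / 2 - 0) < d).
         apply Rabs_lt_between in hy; apply Rabs_def1; lra.
      -- lra.
    * exact is_lim_sinc_0.
  + exact hln.
Qed.

Definition fourier1 (j : nat) : R :=
  match j with
  | 0%nat | 1%nat => 0
  | _ => cos (PI / 2 - INR j * (PI / 2)) * zeta (INR j)
  end.

Lemma cosine_series_expansion (p : nat) :
  converges_inside PI (trig_sum (PI / 2) (S p))
    (fun x => appell fourier1 (S p) x + log_sin_primitive p x).
Proof.
pose proof PI_RGT_0 as hPI.
induction p as [|p IH].
- apply converges_inside_ext with (g := fun x => - ln (2 * sin (x / 2))).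
  + intros x hx; rewrite log_sin_primitive_0 by exact hx.
    unfold appell; rewrite sum_Sn, sum_O; change plus with Rplus; simpl; field.
  + apply converges_inside_sub with (2 * PI); [lra | apply cosine_series_log_sin].
- apply (converges_inside_primitive _ _ (S p)
    (fun x => appell fourier1 (S p) x + log_sin_primitive p x)); [exact hPI | lia | exact IH | |].
  + intros x hx; apply (is_derive_plus (appell fourier1 (S (S p))) (log_sin_primitive (S p))).
    * apply appell_derive.
    * apply log_sin_primitive_derive; lra.
  + replace (cos _ * zeta _) with (plus (appell fourier1 (S (S p)) 0) 0)
      by (rewrite appell_0; apply Rplus_0_r).
    eapply filterlim_comp_2; [| apply log_sin_primitive_lim0 |
      apply (filterlim_plus (V := R_NormedModule))].
    apply (filterlim_filter_le_1 (F := locally 0)); [apply filter_le_within|].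
    apply appell_continuous.
Qed.

(** * Evaluation at pi/3 *)

Lemma cos_PI3_shift (N j : nat) : cos (INR (6 * N + j) * (PI / 3)) = cos (INR j * (PI / 3)).
Proof.
rewrite <- (cos_period (INR j * (PI / 3)) N); f_equal.
rewrite plus_INR, mult_INR; replace (INR 6) with 6 by (simpl; ring); field.
Qed.

Lemma cos_PI3_multiples :
  cos (INR 1 * (PI / 3)) = 1 / 2 /\ cos (INR 2 * (PI / 3)) = - (1 / 2) /\
  cos (INR 3 * (PI / 3)) = - (1) /\ cos (INR 4 * (PI / 3)) = - (1 / 2) /\
  cos (INR 5 * (PI / 3)) = 1 / 2 /\ cos (INR 6 * (PI / 3)) = 1.
Proof.
assert (h3 : forall j, cos (INR (3 + j) * (PI / 3)) = - cos (INR j * (PI / 3))).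
{ intros j; rewrite <- neg_cos; f_equal; rewrite plus_INR; simpl (INR 3); field. }
assert (h1 : cos (INR 1 * (PI / 3)) = 1 / 2) by (rewrite Rmult_1_l; apply cos_PI3).
assert (h2 : cos (INR 2 * (PI / 3)) = - (1 / 2)).
{ replace (INR 2 * (PI / 3)) with (- (PI / 3) + PI) by (simpl; field).
  now rewrite neg_cos, cos_neg, cos_PI3. }
assert (h0 : cos (INR 0 * (PI / 3)) = 1) by (now rewrite Rmult_0_l, cos_0).
pose proof (h3 0%nat); pose proof (h3 1%nat); pose proof (h3 2%nat); pose proof (h3 3%nat).
simpl Nat.add in *; repeat split; lra.
Qed.

(* [2 cos (n pi / 3) = 1 - 2 [2 | n] - 3 [3 | n] + 6 [6 | n]] *)
Lemma cos_PI3_block_sum (z : nat -> R) (N : nat) :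
  (forall m n, z (m * n)%nat = z m * z n) ->
  sum_n_m (fun n => cos (INR n * (PI / 3)) * z n) 1 (6 * N)
  = 1 / 2 * (sum_n_m z 1 (6 * N) - 2 * z 2%nat * sum_n_m z 1 (3 * N)
      - 3 * z 3%nat * sum_n_m z 1 (2 * N) + 6 * z 6%nat * sum_n_m z 1 (1 * N)).
Proof.
intros hz; induction N as [|N IH].
- rewrite !Nat.mul_0_r, !sum_n_m_zero by lia; change zero with 0; in_R; ring.
- destruct cos_PI3_multiples as (h1 & h2 & h3 & h4 & h5 & h6).
  replace (6 * S N)%nat with (S (S (S (S (S (S (6 * N))))))) by lia.
  replace (3 * S N)%nat with (S (S (S (3 * N)))) by lia.
  replace (2 * S N)%nat with (S (S (2 * N))) by lia.
  replace (1 * S N)%nat with (S (1 * N)) by lia.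
  repeat (rewrite sum_n_Sm by lia).
  rewrite IH; change plus with Rplus.
  replace (S (S (S (S (S (S (6 * N))))))) with (6 * N + 6)%nat by lia.
  replace (S (S (S (S (S (6 * N)))))) with (6 * N + 5)%nat by lia.
  replace (S (S (S (S (6 * N))))) with (6 * N + 4)%nat by lia.
  replace (S (S (S (6 * N)))) with (6 * N + 3)%nat by lia.
  replace (S (S (6 * N))) with (6 * N + 2)%nat by lia.
  replace (S (6 * N)) with (6 * N + 1)%nat by lia.
  rewrite !cos_PI3_shift, h1, h2, h3, h4, h5, h6.
  replace (z (6 * N + 2)%nat) with (z 2%nat * z (S (3 * N))) by (rewrite <- hz; f_equal; lia).
  replace (z (6 * N + 4)%nat) with (z 2%nat * z (S (S (3 * N)))) by (rewrite <- hz; f_equal; lia).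
  replace (z (6 * N + 3)%nat) with (z 3%nat * z (S (2 * N))) by (rewrite <- hz; f_equal; lia).
  assert (e1 : z 2%nat * z (S (S (S (3 * N)))) = z (6 * N + 6)%nat)
    by (rewrite <- hz; f_equal; lia).
  assert (e2 : z 3%nat * z (S (S (2 * N))) = z (6 * N + 6)%nat)
    by (rewrite <- hz; f_equal; lia).
  assert (e3 : z 6%nat * z (S (1 * N)) = z (6 * N + 6)%nat)
    by (rewrite <- hz; f_equal; lia).
  in_R; rewrite !Rmult_plus_distr_l; rewrite !Rmult_minus_distr_l.
  rewrite !Rmult_plus_distr_l; rewrite (Rmult_assoc 2 (z 2%nat) (z (S (S (S _))))), e1.
  rewrite (Rmult_assoc 3 (z 3%nat) (z (S (S (2 * N))))), e2, (Rmult_assoc 6 (z 6%nat) (z (S _))), e3.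
  field.
Qed.

Lemma series_block_lim (f : nat -> R) (l : R) (k : nat) : (1 <= k)%nat ->
  is_series (fun n => f (S n)) l -> is_lim_seq (fun N => sum_n_m f 1 (k * S N)) l.
Proof.
intros hk hf.
apply is_lim_seq_ext with (u := fun N => sum_n (fun n => f (S n)) (k * S N - 1)).
- intros N; unfold sum_n; rewrite sum_n_m_S; f_equal; nia.
- apply (is_lim_seq_subseq (sum_n (fun n => f (S n))) l (fun N => (k * S N - 1)%nat)).
  + apply eventually_subseq; intros N; nia.
  + exact hf.
Qed.

Lemma cos_PI3_series (s : nat) : (2 <= s)%nat ->
  Series (fun n => cos (INR (S n) * (PI / 3)) / INR (S n) ^ s)
  = 1 / 2 * (1 - 2 / 2 ^ s - 3 / 3 ^ s + 6 / 6 ^ s) * zeta (INR s).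
Proof.
intros hs; set (z := fun n => / INR n ^ s).
assert (hz : forall m n, z (m * n)%nat = z m * z n)
  by (intros m n; unfold z; rewrite mult_INR, Rpow_mult_distr; apply Rinv_mult).
assert (hZ : is_series (fun n => z (S n)) (zeta (INR s))).
{ rewrite zeta_INR; apply Series_correct, ex_series_inv_pow, hs. }
assert (hC : is_series (fun n => cos (INR (S n) * (PI / 3)) * z (S n))
  (Series (fun n => cos (INR (S n) * (PI / 3)) / INR (S n) ^ s))).
{ apply Series_correct, ex_series_quadratic; intros n.
  destruct (inv_pow_ge2 s n hs); unfold Rdiv; rewrite Rabs_mult, (Rabs_pos_eq (/ _)) by lra.
  assert (Rabs (cos (INR (S n) * (PI / 3))) <= 1) by (apply Rabs_le; split; apply COS_bound).
  pose proof (Rabs_pos (cos (INR (S n) * (PI / 3)))); nra. }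
pose proof (series_block_lim (fun n => cos (INR n * (PI / 3)) * z n) _ 6 ltac:(lia) hC) as hl.
apply (is_lim_seq_ext _ _ _ (fun N => cos_PI3_block_sum z (S N) hz)) in hl.
assert (hr : is_lim_seq (fun N => 1 / 2 * (sum_n_m z 1 (6 * S N)
    - 2 * z 2%nat * sum_n_m z 1 (3 * S N)
    - 3 * z 3%nat * sum_n_m z 1 (2 * S N) + 6 * z 6%nat * sum_n_m z 1 (1 * S N)))
  (1 / 2 * (zeta (INR s) - 2 * z 2%nat * zeta (INR s) - 3 * z 3%nat * zeta (INR s)
    + 6 * z 6%nat * zeta (INR s)))).
{ apply (is_lim_seq_scal_l _ _ (Finite _)).
  apply is_lim_seq_plus'; [apply is_lim_seq_minus'; [apply is_lim_seq_minus'|]|].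
  - now apply series_block_lim; [lia|].
  - apply (is_lim_seq_scal_l _ _ (Finite _)), series_block_lim; [lia | exact hZ].
  - apply (is_lim_seq_scal_l _ _ (Finite _)), series_block_lim; [lia | exact hZ].
  - apply (is_lim_seq_scal_l _ _ (Finite _)), series_block_lim; [lia | exact hZ]. }
apply is_lim_seq_unique in hl; apply is_lim_seq_unique in hr.
rewrite hl in hr; apply (f_equal real) in hr; unfold real in hr.
rewrite hr; unfold z.
replace (INR 2) with 2 by reflexivity; replace (INR 3) with 3 by (simpl; ring).
replace (INR 6) with 6 by (simpl; ring).
field; repeat split; apply pow_nonzero; lra.
Qed.

Lemma trig_series_PI3 (r : nat) : (1 <= r)%nat ->
  trig_series (PI / 2) (2 * r + 1) (PI / 3)
  = (-1) ^ r * (1 / 2 * (1 - / 2 ^ (2 * r)) * (1 - / 3 ^ (2 * r)) * zeta (INR (2 * r + 1))).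
Proof.
intros hr.
replace (_ * _ * (_ - _) * _) with (1 / 2 * (1 - 2 / 2 ^ (2 * r + 1) - 3 / 3 ^ (2 * r + 1)
  + 6 / 6 ^ (2 * r + 1)) * zeta (INR (2 * r + 1))).
- rewrite <- cos_PI3_series, <- Series_scal_l by lia; apply Series_ext; intros n.
  unfold trig_term.
  replace (INR (S n) * (PI / 3) - INR (2 * r + 1) * (PI / 2) + PI / 2)
    with (INR (S n) * (PI / 3) - INR r * PI)
    by (rewrite plus_INR, mult_INR; simpl (INR 2); simpl (INR 1); field).
  rewrite cos_minus, cos_INR_PI, (sin_eq_0_1 (INR r * PI));
    [unfold Rdiv; ring | exists (Z.of_nat r); now rewrite INR_IZR_INZ].
- replace 6 with (2 * 3) at 2 by ring; rewrite Rpow_mult_distr, !(pow_add _ (2 * r)), !pow_1.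
  field; split; apply pow_nonzero; lra.
Qed.

Lemma fourier1_even (k : nat) : fourier1 (2 * k) = 0.
Proof.
destruct k as [|k]; [reflexivity|].
replace (fourier1 (2 * S k))
  with (cos (PI / 2 - INR (2 * S k) * (PI / 2)) * zeta (INR (2 * S k)))
  by now replace (2 * S k)%nat with (S (S (2 * k))) by lia.
replace (PI / 2 - INR (2 * S k) * (PI / 2)) with (- (INR (S k) * PI - PI / 2))
  by (rewrite mult_INR; simpl (INR 2); field).
rewrite cos_neg, cos_sub_PI2_n; ring.
Qed.

Lemma fourier1_odd (k : nat) : (1 <= k)%nat ->
  fourier1 (2 * k + 1) = (-1) ^ k * zeta (INR (2 * k + 1)).
Proof.
intros hk; replace (fourier1 (2 * k + 1))
  with (cos (PI / 2 - INR (2 * k + 1) * (PI / 2)) * zeta (INR (2 * k + 1)))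
  by now replace (2 * k + 1)%nat with (S (S (2 * k - 1))) by lia.
rewrite <- cos_INR_PI, <- (cos_neg (INR k * PI)); do 2 f_equal.
rewrite plus_INR, mult_INR; simpl (INR 2); simpl (INR 1); field.
Qed.

Lemma sum_n_rev (f : nat -> R) (n : nat) : sum_n f n = sum_n (fun k => f (n - k)%nat) n.
Proof.
induction n as [|n IH]; [now rewrite !sum_O|].
rewrite sum_Sn, IH; unfold sum_n at 2; rewrite sum_Sn_m by lia.
rewrite <- sum_n_m_S, Nat.sub_0_r; apply Rplus_comm.
Qed.

Lemma appell_fourier1 (r : nat) (x : R) : (1 <= r)%nat ->
  appell fourier1 (2 * r + 1) x = (-1) ^ r * (zeta (INR (2 * r + 1))
    - sum_n_m (fun k => (-1) ^ (k - 1) * (1 / INR (fact (2 * k))) * x ^ (2 * k)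
                        * zeta (2 * INR r + 1 - 2 * INR k)) 1 (r - 1)).
Proof.
intros hr; unfold appell; rewrite sum_n_even_odd.
rewrite (sum_n_ext (fun j => fourier1 (2 * j) * _ / _) (fun _ => 0)).
2: { intros j; rewrite fourier1_even; unfold Rdiv; in_R; ring. }
rewrite sum_n_const, Rmult_0_r, Rplus_0_l.
set (g := fun j : nat => fourier1 (2 * j + 1) * x ^ (2 * r + 1 - (2 * j + 1))
                  / INR (fact (2 * r + 1 - (2 * j + 1)))).
destruct r as [|q]; [lia|].
change (sum_n _ (S q)) with (sum_n g (S q)); rewrite sum_Sn, Rmult_minus_distr_l; change plus with Rplus.
rewrite Rplus_comm; unfold Rminus; f_equal.
{ unfold g; rewrite Nat.sub_diag, fourier1_odd by lia; simpl; field. }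
rewrite sum_n_rev; replace (S q - 1)%nat with q by lia.
assert (hg0 : g 0%nat = 0) by (unfold g; simpl (fourier1 (2 * 0 + 1)); unfold Rdiv; ring).
destruct q as [|p].
{ rewrite sum_O, sum_n_m_zero by lia; change zero with 0; simpl Nat.sub; rewrite hg0; in_R; ring. }
rewrite sum_Sn, Nat.sub_diag, hg0; change plus with Rplus; rewrite Rplus_0_r.
rewrite <- sum_n_m_S, Ropp_mult_distr_l.
rewrite <- (sum_n_m_mult_l (K := R_Ring) (- (-1) ^ S (S p))).
apply sum_n_m_ext_loc; intros k hk; unfold g; change mult with Rmult; in_R.
rewrite fourier1_odd by lia.
replace (2 * S (S p) + 1 - (2 * (S p - k) + 1))%nat with (2 * S k)%nat by lia.
replace (2 * INR (S (S p)) + 1 + - (2 * INR (S k))) with (INR (2 * (S p - k) + 1)).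
2: { rewrite plus_INR, mult_INR, minus_INR, !S_INR by lia; simpl (INR 0); ring. }
replace (S k - 1)%nat with k by lia.
replace (- (-1) ^ S (S p) * _) with ((- (-1) ^ S (S p) * (-1) ^ k) * (1 / INR (fact (2 * S k))
  * x ^ (2 * S k) * zeta (INR (2 * (S p - k) + 1)))) by ring.
replace (- (-1) ^ S (S p) * (-1) ^ k) with ((-1) ^ (S p - k)).
- field; apply INR_fact_neq_0.
- replace (S (S p)) with (S (S p - k + k)) by lia; rewrite <- tech_pow_Rmult, pow_add.
  replace (- (-1 * ((-1) ^ (S p - k) * (-1) ^ k)) * (-1) ^ k)
    with ((-1) ^ (S p - k) * ((-1) ^ k * (-1) ^ k)) by ring.
  rewrite <- (Rpow_mult_distr (-1) (-1) k); replace (-1 * -1) with 1 by ring.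
  rewrite pow1; ring.
Qed.

Lemma PSeries_Int_iter (p : nat) (a : nat -> R) (x : R) :
  PSeries (PS_Int_iter p a) x
  = x ^ p * PSeries (fun i => a i * INR (fact i) / INR (fact (i + p))) x.
Proof.
rewrite <- PSeries_incr_n; apply PSeries_ext.
induction p as [|p IH]; intros n.
- simpl; rewrite Nat.add_0_r; field; apply INR_fact_neq_0.
- destruct n as [|n]; [reflexivity|].
  change (PS_Int_iter (S p) a (S n)) with (PS_Int_iter p a n / INR (S n)).
  rewrite IH, !PS_incr_n_simplify.
  destruct (le_lt_dec p n) as [h|h]; destruct (le_lt_dec (S p) (S n)) as [h'|h']; try lia.
  + replace (S n - S p)%nat with (n - p)%nat by lia.
    replace (n - p + S p)%nat with (S n) by lia; replace (n - p + p)%nat with n by lia.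
    rewrite (fact_simpl n), mult_INR; in_R.
    field; split; [apply INR_fact_neq_0 | apply not_0_INR; lia].
  + change zero with 0; unfold Rdiv; in_R; ring.
Qed.

Definition log_sin_tail (r : nat) (x : R) (k : nat) : R :=
  - (bern_coef k * INR (fact (2 * k)) / (INR (fact (2 * r + 2 * k)) * INR k)) * x ^ (2 * k).

Lemma log_sin_primitive_tail (r : nat) (x : R) : Rabs x < 2 * PI ->
  ex_series (fun n => log_sin_tail r x (S n)) /\
  PSeries (PS_Int_iter (2 * r) log_coef) x = x ^ (2 * r) * (1 / 2 * Series (fun n => log_sin_tail r x (S n))).
Proof.
intros hx; pose proof PI_RGT_0 as hPI; rewrite PSeries_Int_iter.
set (d := fun i : nat => log_coef i * INR (fact i) / INR (fact (i + 2 * r))).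
assert (hd : ex_pseries (fun k => d (2 * k)%nat) (x ^ 2)).
{ apply CV_radius_inside, Rbar_lt_le_trans with (Finite ((2 * PI) ^ 2)).
  - change (Rabs (x ^ 2) < (2 * PI) ^ 2); rewrite <- RPow_abs; pose proof (Rabs_pos x); nra.
  - apply CV_radius_ge with 4; intros k; rewrite <- pow_mult.
    destruct k as [|k].
    { unfold d; change (log_coef (2 * 0)) with 0; unfold Rdiv; rewrite !Rmult_0_l, Rabs_R0; lra. }
    unfold d; rewrite log_coef_even by lia.
    replace (_ * _) with (bern_coef (S k) * (2 * PI) ^ (2 * S k) *
      - (/ INR (2 * S k) * (INR (fact (2 * S k)) / INR (fact (2 * S k + 2 * r)))))
      by (unfold Rdiv; ring).
    assert (h1 : 1 <= INR (2 * S k)) by (apply (le_INR 1); lia).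
    assert (h2 : INR (fact (2 * S k)) <= INR (fact (2 * S k + 2 * r)))
      by (apply le_INR, fact_le; lia).
    pose proof (INR_fact_lt_0 (2 * S k)) as h3.
    assert (0 < / INR (2 * S k) <= 1).
    { split; [apply Rinv_0_lt_compat; lra|].
      rewrite <- Rinv_1; apply Rinv_le_contravar; lra. }
    assert (0 < INR (fact (2 * S k)) / INR (fact (2 * S k + 2 * r)) <= 1).
    { split; [apply Rdiv_lt_0_compat; lra|].
      apply Rmult_le_reg_r with (INR (fact (2 * S k + 2 * r))); [lra|].
      unfold Rdiv; rewrite Rmult_assoc, Rinv_l by lra; lra. }
    rewrite Rabs_mult, Rabs_Ropp, (Rabs_pos_eq (/ _ * _)) by nra.
    pose proof (bern_coef_bound (S k)).
    pose proof (Rabs_pos (bern_coef (S k) * (2 * PI) ^ (2 * S k))).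
    set (u := / INR (2 * S k)) in *; set (v := INR (fact (2 * S k)) / _) in *.
    assert (0 < u * v <= 1) by nra; nra. }
assert (hdodd : forall k, d (2 * k + 1)%nat = 0)
  by (intros k; unfold d; rewrite log_coef_odd; unfold Rdiv; ring).
rewrite (PSeries_even d x hdodd hd); unfold PSeries.
apply ex_pseries_R in hd.
assert (hterm : forall n, d (2 * S n)%nat * (x ^ 2) ^ S n = 1 / 2 * log_sin_tail r x (S n)).
{ intros n; unfold d, log_sin_tail; rewrite log_coef_even, <- pow_mult by lia.
  rewrite (Nat.add_comm (2 * S n)), (mult_INR 2); simpl (INR 2).
  field; split; [apply not_0_INR; lia | apply INR_fact_neq_0]. }
pose proof (proj1 (ex_series_incr_1 _) hd) as hd1.
split.
- apply ex_series_ext with (fun n => 2 * (d (2 * S n)%nat * (x ^ 2) ^ S n)).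
  + intros n; rewrite hterm; in_R; field.
  + exact (ex_series_scal_l (V := R_NormedModule) 2 _ hd1).
- f_equal; rewrite Series_incr_1 by exact hd.
  rewrite <- Series_scal_l, (Series_ext _ _ hterm).
  replace (d (2 * 0)%nat) with 0 by (unfold d; change (log_coef (2 * 0)) with 0; unfold Rdiv; ring).
  in_R; ring.
Qed.

(* "Stdlib + Coquelicot" world.  Sums over k >= 1 are indexed by n with k = S n;
   the convergence implicit in an infinite sum is part of the conclusion. *)
Theorem theorem17 (r : nat) (hr : (1 <= r)%nat)
    (B : nat -> R) (hB : is_bernoulli_star B) :
  let D := 3 ^ (2 * r) * (2 ^ (2 * r) + 1) + 2 ^ (2 * r) - 1 in
  let a := fun k : nat =>
    INR (fact (2 * k - 1)) / INR (fact (2 * r + 2 * k))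
    * (zeta (2 * INR k) / 6 ^ (2 * k)) in
  let b := fun k : nat =>
    B k / (INR (fact (2 * r + 2 * k)) * INR k) * (PI / 3) ^ (2 * k) in
  (ex_series (fun n => a (S n)) /\
   zeta (2 * INR r + 1) =
     2 ^ (2 * r + 1) * 3 ^ (2 * r) / D
       * sum_n_m (fun k => (-1) ^ (k - 1) * (1 / INR (fact (2 * k)))
                           * (PI / 3) ^ (2 * k)
                           * zeta (2 * INR r + 1 - 2 * INR k)) 1 (r - 1)
     + (-1) ^ (r - 1)
       * (2 ^ (2 * r + 1) * PI ^ (2 * r) / (D * INR (fact (2 * r))))
       * (harmonic (2 * r) - ln (PI / 3))
     + (-1) ^ (r - 1) * (4 * (2 * PI) ^ (2 * r) / D)
       * Series (fun n => a (S n)))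
  /\
  (ex_series (fun n => b (S n)) /\
   zeta (2 * INR r + 1) =
     2 ^ (2 * r + 1) * 3 ^ (2 * r) / D
       * sum_n_m (fun k => (-1) ^ (k - 1) * (1 / INR (fact (2 * k)))
                           * (PI / 3) ^ (2 * k)
                           * zeta (2 * INR r + 1 - 2 * INR k)) 1 (r - 1)
     + (-1) ^ (r - 1)
       * (2 ^ (2 * r + 1) * PI ^ (2 * r) / (D * INR (fact (2 * r))))
       * (harmonic (2 * r) - ln (PI / 3))
     + (-1) ^ (r - 1) * ((2 * PI) ^ (2 * r) / D)
       * Series (fun n => b (S n))).
Proof.
intros D a b; pose proof PI_RGT_0 as hPI.
destruct (log_sin_primitive_tail r (PI / 3)) as [hex htail];
  [rewrite Rabs_pos_eq; lra|].
assert (hbc : forall n, log_sin_tail r (PI / 3) (S n) = b (S n)).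
{ intros n; unfold b, log_sin_tail; rewrite (bern_coef_bernoulli B hB) by lia.
  field; split; [apply not_0_INR; lia | apply INR_fact_neq_0]. }
assert (hba : forall n, b (S n) = 4 * a (S n)).
{ intros n; unfold a, b; rewrite (bern_coef_bernoulli B hB) by lia.
  replace (2 * INR (S n)) with (INR (2 * S n)) by (now rewrite mult_INR).
  unfold bern_coef.
  replace (2 * S n - 1)%nat with (2 * n + 1)%nat by lia.
  replace (fact (2 * S n)) with (2 * S n * fact (2 * n + 1))%nat
    by (replace (2 * S n)%nat with (S (2 * n + 1)) by lia; now rewrite fact_simpl).
  rewrite !mult_INR; simpl (INR 2).
  replace ((2 * PI) ^ (2 * S n)) with (6 ^ (2 * S n) * (PI / 3) ^ (2 * S n))
    by (rewrite <- Rpow_mult_distr; f_equal; field).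
  field; repeat split; try apply pow_nonzero; try apply INR_fact_neq_0;
    try (apply not_0_INR; lia); lra. }
apply (ex_series_ext _ _ hbc) in hex; rewrite (Series_ext _ _ hbc) in htail.
assert (hexa : ex_series (fun n => a (S n))).
{ apply ex_series_ext with (fun n => / 4 * b (S n)); [intros n; rewrite hba; in_R; field|].
  exact (ex_series_scal_l (V := R_NormedModule) (/ 4) _ hex). }
assert (hS : Series (fun n => b (S n)) = 4 * Series (fun n => a (S n)))
  by (rewrite <- Series_scal_l; now apply Series_ext).
assert (main : zeta (2 * INR r + 1) =
     2 ^ (2 * r + 1) * 3 ^ (2 * r) / D
       * sum_n_m (fun k => (-1) ^ (k - 1) * (1 / INR (fact (2 * k)))
                           * (PI / 3) ^ (2 * k)
                           * zeta (2 * INR r + 1 - 2 * INR k)) 1 (r - 1)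
     + (-1) ^ (r - 1)
       * (2 ^ (2 * r + 1) * PI ^ (2 * r) / (D * INR (fact (2 * r))))
       * (harmonic (2 * r) - ln (PI / 3))
     + (-1) ^ (r - 1) * ((2 * PI) ^ (2 * r) / D)
       * Series (fun n => b (S n))).
{ assert (hval : trig_series (PI / 2) (2 * r + 1) (PI / 3)
    = appell fourier1 (2 * r + 1) (PI / 3) + log_sin_primitive (2 * r) (PI / 3)).
  { apply (converges_inside_eq _ PI _ (fun x => appell fourier1 (2 * r + 1) x
      + log_sin_primitive (2 * r) x)); [lia | | lra].
    rewrite Nat.add_1_r; apply cosine_series_expansion. }
  rewrite trig_series_PI3, appell_fourier1 in hval by exact hr.
  unfold log_sin_primitive in hval; rewrite htail in hval.
  replace (INR (2 * r + 1)) with (2 * INR r + 1) in hval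
    by (rewrite plus_INR, mult_INR; reflexivity).
  set (S1 := sum_n_m _ 1 (r - 1)) in *.
  replace ((PI / 3) ^ (2 * r)) with (PI ^ (2 * r) / 3 ^ (2 * r)) in hval
    by (unfold Rdiv; now rewrite Rpow_mult_distr, pow_inv).
  replace ((-1) ^ r) with (- (-1) ^ (r - 1)) in hval
    by (replace r with (S (r - 1)) at 2 by lia; simpl; ring).
  rewrite Rpow_mult_distr, (pow_add 2), pow_1.
  assert (hsg : (-1) ^ (r - 1) * (-1) ^ (r - 1) = 1).
  { rewrite <- Rpow_mult_distr; replace (-1 * -1) with 1 by ring; apply pow1. }
  assert (hp : 1 <= 2 ^ (2 * r)) by (apply pow_R1_Rle; lra).
  assert (hq : 1 <= 3 ^ (2 * r)) by (apply pow_R1_Rle; lra).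
  pose proof (INR_fact_neq_0 (2 * r)) as hF.
  set (sg := (-1) ^ (r - 1)) in *; set (p := 2 ^ (2 * r)) in *; set (q := 3 ^ (2 * r)) in *.
  set (F := INR (fact (2 * r))) in *; set (P := PI ^ (2 * r)) in *.
  set (H := harmonic (2 * r) - ln (PI / 3)) in *.
  set (T := Series (fun n => b (S n))) in *; set (Z := zeta (2 * INR r + 1)) in *.
  assert (hD : 0 < D) by (unfold D; nra).
  assert (hZ : D * Z = 2 * p * q * S1 + sg * (2 * p * P / F) * H + sg * (p * P) * T).
  { apply (f_equal (Rmult (- sg * (2 * p * q)))) in hval.
    replace (- sg * (2 * p * q) * (- sg * (1 / 2 * (1 - / p) * (1 - / q) * Z)))
      with ((sg * sg) * ((p - 1) * (q - 1) * Z)) in hval by (field; lra).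
    replace (- sg * (2 * p * q) * _) with (sg * sg * (2 * p * q * (Z - S1))
      - sg * (2 * p * P / F) * H - sg * (p * P) * T) in hval by (field; lra).
    rewrite hsg in hval; unfold D; lra. }
  apply Rmult_eq_reg_l with D; [|lra]; rewrite hZ; field; lra. }
split; split; try assumption.
rewrite main at 1; rewrite hS; f_equal; unfold Rdiv; ring.
Qed.
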